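(* For every $\alpha\in[0,2)$ there exists $f(z)=z+\sum_{n\ge2}a_nz^n$ in $S_{\mathbb{R}}$ such that $a_2=\alpha$ and $f'\notin N$.
   Context: $\mathbb{D}$ is the open unit disk. $S_{\mathbb{R}}$ is the class of univalent (injective holomorphic) functions $f(z)=z+\sum_{n=2}^\infty a_nz^n$ in $\mathbb{D}$ with all coefficients $a_n$ real. The Nevanlinna class $N$ consists of the holomorphic functions $g$ in $\mathbb{D}$ with $\sup_{r\in(0,1)}\int_0^{2\pi}\log^+|g(re^{i\theta})|\,d\theta<\infty$, where $\log^+x=\max\{0,\log x\}$. *)

(* Defs.v *)
From Stdlib Require Import Reals.
From Coquelicot Require Import Coquelicot.

Open Scope R_scope.

Definition unit_disk (z : C) : Prop := Cmod z < 1.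

(* Functions on the disk are total functions [C -> C]; their values outside
   the disk are irrelevant, since the disk is open. *)
Definition holomorphic_in_disk (f : C -> C) : Prop :=
  forall z : C, unit_disk z ->
    @ex_derive C_AbsRing C_NormedModule f z.

Definition univalent (f : C -> C) : Prop :=
  holomorphic_in_disk f /\
  (forall z w : C, unit_disk z -> unit_disk w -> f z = f w -> z = w).

(* f(z) = z + sum_{n >= 2} a_n z^n in the disk, with real a_n. *)
Definition normalized_real_expansion (f : C -> C) (a : nat -> R) : Prop :=
  a 0%nat = 0 /\ a 1%nat = 1 /\
  (forall z : C, unit_disk z ->
     @is_pseries C_AbsRing C_NormedModule (fun n => RtoC (a n)) z (f z)).

Definition S_R (f : C -> C) : Prop :=
  univalent f /\ exists a : nat -> R, normalized_real_expansion f a.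

(* [ln x = 0] for [x <= 0], so [log_plus 0 = 0]. *)
Definition log_plus (x : R) : R := Rmax 0 (ln x).

Definition circle_point (r theta : R) : C := (r * cos theta, r * sin theta).

Definition log_plus_mean (g : C -> C) (r : R) : R :=
  RInt (fun theta => log_plus (Cmod (g (circle_point r theta)))) 0 (2 * PI).

(* For g holomorphic in the disk and 0 < r < 1 the integrand is continuous, so
   the total operator [RInt] is the actual integral. *)
Definition nevanlinna (g : C -> C) : Prop :=
  holomorphic_in_disk g /\
  Rbar_lt
    (Lub_Rbar (fun y => exists r : R, 0 < r < 1 /\ y = log_plus_mean g r))
    p_infty.

(* Main.v *)
Require Import Defs.
From Stdlib Require Import Reals Lra Lia Psatz List.
From Coquelicot Require Import Coquelicot.

(** Put r = alpha / 2.  The dilated Koebe function k(z) = z / (1 - r z)^2 has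
    second coefficient alpha, and since r < 1 it is bi-Lipschitz on the disk.
    The example is the primitive f of k' * exp h, where
    h(z) = eps * (l(z) - z), l(z) = z + z^4 + z^16 + ..., and eps > 0 is small
    compared with the bi-Lipschitz constants of k.  As h has no linear term, f
    has the same first two coefficients as k.

    f is injective because h has a small Bloch constant: h' is bounded by
    2 eps / (1 - |z|).  Given z <> w there is a point p at distance about
    |z - w| from the circle from which z and w are reached along segments that
    approach the circle linearly.  On such a segment h moves away from h(p) by
    at most a small multiple of a logarithm, exp(h - h(p)) - 1 has a small
    integral, and f(z) - f(w) differs from exp(h(p)) (k(z) - k(w)) by less than
    the modulus of the latter ([perturbation_injective]).

    f' is not of bounded characteristic because log |f'| is, up to a bounded
    term, eps * Re l, and the positive part of Re l has unbounded means.  The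
    identity l(z) = z + l(z^4) expresses the moments of Re l on the circle of
    radius rho through those on the circle of radius rho^4: the first moment
    vanishes, the second one tends to infinity as rho tends to 1, and the fourth
    one is at most a constant times the square of the second, as for a Gaussian
    variable.  Then the mean of |Re l|, hence that of its positive part, is at
    least a constant times the square root of the second moment
    ([circle_int_lower_unbounded]).

    The function exp h enters only through its Taylor coefficients b_n, given by
    the differential equation G' = h' G; they lie in [0, 1], and |G| = exp (Re h)
    follows from the same equation. *)

Open Scope R_scope.

(** * Complex derivatives along segments, and complex series *)

Definition has_cderiv (F : C -> C) (z l : C) : Prop :=
  @is_derive C_AbsRing C_NormedModule F z l.

Lemma locally_Cmod (z : C) (P : C -> Prop) :
  @locally (AbsRing_UniformSpace C_AbsRing) z P <->
  exists d, 0 < d /\ forall y, Cmod (y - z) < d -> P y.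
Proof.
  split.
  - intros [d Hd]. exists d. split; [apply cond_pos|].
    intros y Hy. apply Hd. exact Hy.
  - intros [d [Hd H]]. exists (mkposreal d Hd). intros y Hy. apply H. exact Hy.
Qed.

(** The form of the derivative that both the power series estimate and the
    restriction to segments rely on. *)
Lemma has_cderiv_iff (F : C -> C) (z l : C) :
  has_cderiv F z l <->
  forall e, 0 < e -> exists d, 0 < d /\ forall y, Cmod (y - z) < d ->
    Cmod (F y - F z - (y - z) * l) <= e * Cmod (y - z).
Proof.
  split.
  - intros [_ H] e He.
    specialize (H z (fun P HP => HP) (mkposreal e He)).
    apply (proj1 (locally_Cmod z _)) in H. exact H.
  - intros H. split; [apply is_linear_scal_l|].
    intros x Hx. apply @is_filter_lim_locally_unique in Hx. subst x.
    intros e. apply (proj2 (locally_Cmod z _)).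
    apply (H e (cond_pos e)).
Qed.

Lemma C_derive_eq (F : C -> C) (z l : C) : has_cderiv F z l -> C_derive F z = l.
Proof. intros H. apply is_C_derive_unique. exact H. Qed.

Lemma has_cderiv_continuous (F : C -> C) (z l : C) :
  has_cderiv F z l ->
  forall e, 0 < e -> exists d, 0 < d /\ forall y, Cmod (y - z) < d ->
    Cmod (F y - F z) < e.
Proof.
  intros H e He.
  destruct (proj1 (has_cderiv_iff F z l) H 1 Rlt_0_1) as [d [Hd Hy]].
  assert (HL : 0 < 1 + Cmod l) by (pose proof (Cmod_ge_0 l); lra).
  exists (Rmin d (e / (1 + Cmod l))).
  assert (0 < e / (1 + Cmod l)) by (apply Rdiv_lt_0_compat; lra).
  split; [apply Rmin_pos; lra|].
  intros y Hyd.
  pose proof (Rmin_l d (e / (1 + Cmod l))). pose proof (Rmin_r d (e / (1 + Cmod l))).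
  specialize (Hy y ltac:(lra)).
  replace (F y - F z)%C with ((F y - F z - (y - z) * l) + (y - z) * l)%C by ring.
  eapply Rle_lt_trans; [apply Cmod_triangle|]. rewrite Cmod_mult.
  apply Rle_lt_trans with (Cmod (y - z) * (1 + Cmod l)); [nra|].
  apply Rlt_le_trans with (e / (1 + Cmod l) * (1 + Cmod l)); [|right; field; lra].
  apply Rmult_lt_compat_r; lra.
Qed.

Lemma has_cderiv_quadratic (F : C -> C) (z l : C) (d K : R) :
  0 < d -> 0 <= K ->
  (forall y, Cmod (y - z) < d ->
     Cmod (F y - F z - (y - z) * l) <= K * (Cmod (y - z) * Cmod (y - z))) ->
  has_cderiv F z l.
Proof.
  intros Hd HK H. apply has_cderiv_iff. intros e He.
  assert (0 < e / (1 + K)) by (apply Rdiv_lt_0_compat; lra).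
  exists (Rmin d (e / (1 + K))). split; [apply Rmin_pos; lra|].
  intros y Hy.
  pose proof (Rmin_l d (e / (1 + K))). pose proof (Rmin_r d (e / (1 + K))).
  eapply Rle_trans; [apply H; lra|].
  rewrite <- Rmult_assoc. apply Rmult_le_compat_r; [apply Cmod_ge_0|].
  apply Rle_trans with (K * (e / (1 + K))).
  - apply Rmult_le_compat_l; lra.
  - apply Rle_trans with ((1 + K) * (e / (1 + K))); [|right; field; lra].
    apply Rmult_le_compat_r; lra.
Qed.

Lemma has_cderiv_scal_const (F : C -> C) (z l c : C) :
  has_cderiv F z l -> has_cderiv (fun y => c * F y)%C z (c * l)%C.
Proof.
  intros H. apply has_cderiv_iff. intros e He.
  assert (Hc := Cmod_ge_0 c).
  destruct (proj1 (has_cderiv_iff F z l) H (e / (1 + Cmod c))) as [d [Hd Hy]].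
  { apply Rdiv_lt_0_compat; lra. }
  exists d. split; [exact Hd|]. intros y Hyd. specialize (Hy y Hyd).
  replace (c * F y - c * F z - (y - z) * (c * l))%C
    with (c * (F y - F z - (y - z) * l))%C by ring.
  rewrite Cmod_mult.
  apply Rle_trans with (Cmod c * (e / (1 + Cmod c) * Cmod (y - z))).
  - apply Rmult_le_compat_l; assumption.
  - rewrite <- Rmult_assoc. apply Rmult_le_compat_r; [apply Cmod_ge_0|].
    apply Rle_trans with ((1 + Cmod c) * (e / (1 + Cmod c))); [|right; field; lra].
    apply Rmult_le_compat_r; [|lra]. apply Rlt_le, Rdiv_lt_0_compat; lra.
Qed.

Lemma has_cderiv_minus (F H : C -> C) (z l m : C) :
  has_cderiv F z l -> has_cderiv H z m ->
  has_cderiv (fun y => F y - H y)%C z (l - m)%C.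
Proof. intros HF HH. exact (is_derive_minus (V := C_NormedModule) F H z l m HF HH). Qed.

Lemma exp_le_compat (x y : R) : x <= y -> exp x <= exp y.
Proof.
  intros [Hlt|E]; [apply Rlt_le, exp_increasing, Hlt|rewrite E; apply Rle_refl].
Qed.

Lemma Re_le_Cmod (z : C) : Rabs (Re z) <= Cmod z.
Proof. apply re_le_Cmod. Qed.

Lemma Im_le_Cmod (z : C) : Rabs (Im z) <= Cmod z.
Proof. eapply Rle_trans; [apply Rmax_r|apply Rmax_Cmod]. Qed.

Definition seg (p v : C) (u : R) : C := (p + RtoC u * v)%C.

(** Splits a complex derivative into two real ones along a line, which is what
    gives access to the real mean value theorem. *)
Lemma seg_derive (F : C -> C) (p v l : C) (u : R) :
  has_cderiv F (seg p v u) l ->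
  is_derive (fun t => Re (F (seg p v t))) u (Re (l * v)%C) /\
  is_derive (fun t => Im (F (seg p v t))) u (Im (l * v)%C).
Proof.
  intros H.
  assert (Key : forall e, 0 < e -> exists d, 0 < d /\ forall h : R, Rabs h < d ->
     Cmod (F (seg p v (u + h)) - F (seg p v u) - RtoC h * (l * v)) <= e * Rabs h).
  { intros e He. assert (Hv := Cmod_ge_0 v).
    destruct (proj1 (has_cderiv_iff F _ l) H (e / (1 + Cmod v))) as [d [Hd Hy]].
    { apply Rdiv_lt_0_compat; lra. }
    exists (d / (1 + Cmod v)). split; [apply Rdiv_lt_0_compat; lra|].
    intros h Hh.
    assert (E : (seg p v (u + h) - seg p v u)%C = (RtoC h * v)%C).
    { unfold seg. rewrite RtoC_plus. ring. }
    specialize (Hy (seg p v (u + h))). rewrite E, Cmod_mult, Cmod_R in Hy.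
    replace (RtoC h * (l * v))%C with (RtoC h * v * l)%C by ring.
    assert (Hb := Rabs_pos h).
    apply Rle_trans with (e / (1 + Cmod v) * (Rabs h * Cmod v)).
    - apply Hy. apply Rle_lt_trans with (Rabs h * (1 + Cmod v)); [nra|].
      apply Rlt_le_trans with (d / (1 + Cmod v) * (1 + Cmod v)); [|right; field; lra].
      apply Rmult_lt_compat_r; lra.
    - apply Rle_trans with (e / (1 + Cmod v) * (1 + Cmod v) * Rabs h); [|right; field; lra].
      assert (0 < e / (1 + Cmod v)) by (apply Rdiv_lt_0_compat; lra). nra. }
  assert (Q : forall (P : C -> R), (forall a b, P (a - b)%C = P a - P b) ->
     (forall (h : R) w, P (RtoC h * w)%C = h * P w) -> (forall w, Rabs (P w) <= Cmod w) ->
     is_derive (fun t => P (F (seg p v t))) u (P (l * v)%C)).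
  { intros P Pm Ps Pb. apply is_derive_Reals. intros e He.
    destruct (Key (e / 2)) as [d [Hd Hh]]; [lra|].
    exists (mkposreal d Hd). intros h Hh0 Hhd. specialize (Hh h Hhd).
    replace ((P (F (seg p v (u + h))) - P (F (seg p v u))) / h - P (l * v)%C)
      with (P (F (seg p v (u + h)) - F (seg p v u) - RtoC h * (l * v))%C / h).
    2:{ rewrite !Pm, Ps. field. exact Hh0. }
    unfold Rdiv at 1. rewrite Rabs_mult, Rabs_inv.
    assert (0 < Rabs h) by (apply Rabs_pos_lt; exact Hh0).
    apply Rle_lt_trans with (e / 2 * Rabs h * / Rabs h).
    - apply Rmult_le_compat_r; [apply Rlt_le, Rinv_0_lt_compat; lra|].
      eapply Rle_trans; [apply Pb|exact Hh].
    - field_simplify; lra. }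
  split.
  - apply (Q Re); [intros; reflexivity| |apply Re_le_Cmod].
    intros h [w1 w2]; unfold Re, Im, Cmult, RtoC; simpl; ring.
  - apply (Q Im); [intros; reflexivity| |apply Im_le_Cmod].
    intros h [w1 w2]; unfold Re, Im, Cmult, RtoC; simpl; ring.
Qed.

Lemma derive_nonneg_incr (f df : R -> R) (a b : R) :
  a <= b ->
  (forall u, a < u < b -> is_derive f u (df u)) ->
  (forall u, a <= u <= b -> continuity_pt f u) ->
  (forall u, a < u < b -> 0 <= df u) ->
  f a <= f b.
Proof.
  intros Hab Hd Hc Hpos.
  (* The intermediate point may be an endpoint, where df is arbitrary; truncating
     df at 0 keeps the sign there. *)
  destruct (MVT_gen f a b (fun u => Rmax 0 (df u))) as [c [_ Hm]].
  - intros x Hx. rewrite Rmin_left, Rmax_right in Hx by lra.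
    rewrite Rmax_right by (apply Hpos; lra). apply Hd; lra.
  - intros x Hx. rewrite Rmin_left, Rmax_right in Hx by lra. apply Hc; lra.
  - pose proof (Rmax_l 0 (df c)). nra.
Qed.

Lemma Cmod_sq (z : C) : Cmod z * Cmod z = Re z * Re z + Im z * Im z.
Proof. pose proof (Cmod2_alt z). simpl in H. lra. Qed.

(** With D the increment of F, the function |D| psi(u) - Re (conj D * F(p + u v))
    is nondecreasing by the Cauchy-Schwarz inequality.  The majorant psi has to be
    differentiable only inside the interval: it will be - 2 sqrt (1 - u) - u on
    [0, 1], whose derivative blows up at 1. *)
Lemma mean_value_seg (F dF : C -> C) (p v : C) (psi dpsi : R -> R) (b : R) :
  0 <= b ->
  (forall u, 0 <= u <= b -> has_cderiv F (seg p v u) (dF (seg p v u))) ->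
  (forall u, 0 < u < b -> is_derive psi u (dpsi u)) ->
  (forall u, 0 <= u <= b -> continuity_pt psi u) ->
  (forall u, 0 < u < b -> Cmod (dF (seg p v u) * v) <= dpsi u) ->
  Cmod (F (seg p v b) - F p) <= psi b - psi 0.
Proof.
  intros Hb HF Hpsi Hc Hle.
  set (D := (F (seg p v b) - F p)%C).
  assert (HN := Cmod_ge_0 D).
  assert (E0 : seg p v 0 = p) by (unfold seg; ring).
  set (g := fun u => Cmod D * psi u - Re D * Re (F (seg p v u)) - Im D * Im (F (seg p v u))).
  assert (G : g 0 <= g b).
  { apply derive_nonneg_incr with
      (df := fun u => Cmod D * dpsi u - Re D * Re (dF (seg p v u) * v)%C
                      - Im D * Im (dF (seg p v u) * v)%C); [exact Hb| | |].
    - intros u Hu. destruct (seg_derive F p v _ u (HF u ltac:(lra))) as [H1 H2].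
      unfold g.
      apply (is_derive_minus (V := R_NormedModule)
        (fun u => Cmod D * psi u - Re D * Re (F (seg p v u)))
        (fun u => Im D * Im (F (seg p v u)))).
      + apply (is_derive_minus (V := R_NormedModule) (fun u => Cmod D * psi u)
          (fun u => Re D * Re (F (seg p v u)))).
        * apply (is_derive_scal psi u (Cmod D)). apply Hpsi; lra.
        * apply (is_derive_scal (fun t => Re (F (seg p v t)))). exact H1.
      + apply (is_derive_scal (fun t => Im (F (seg p v t)))). exact H2.
    - intros u Hu. destruct (seg_derive F p v _ u (HF u ltac:(lra))) as [H1 H2].
      unfold g. apply continuity_pt_minus; [apply continuity_pt_minus|].
      + apply continuity_pt_scal. apply Hc; lra.
      + apply (continuity_pt_scal (fun t => Re (F (seg p v t)))).
        apply derivable_continuous_pt. exists (Re (dF (seg p v u) * v)%C).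
        apply is_derive_Reals. exact H1.
      + apply (continuity_pt_scal (fun t => Im (F (seg p v t)))).
        apply derivable_continuous_pt. exists (Im (dF (seg p v u) * v)%C).
        apply is_derive_Reals. exact H2.
    - intros u Hu. specialize (Hle u Hu).
      set (w := (dF (seg p v u) * v)%C) in *.
      assert (HS : Re D * Re w + Im D * Im w <= Cmod D * Cmod w).
      { rewrite <- (Cmod_conj D) at 1. rewrite <- Cmod_mult.
        eapply Rle_trans; [|apply Re_le_Cmod]. eapply Rle_trans; [|apply Rle_abs].
        right. unfold Re, Im, Cconj, Cmult; simpl; ring. }
      nra. }
  unfold g in G. rewrite E0 in G.
  assert (E : Re D * Re D + Im D * Im D <= Cmod D * (psi b - psi 0)).
  { assert (Re D = Re (F (seg p v b)) - Re (F p)) by reflexivity.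
    assert (Im D = Im (F (seg p v b)) - Im (F p)) by reflexivity. nra. }
  rewrite <- Cmod_sq in E.
  destruct (Req_dec (Cmod D) 0) as [Z|NZ]; [|apply Rmult_le_reg_l with (Cmod D); lra].
  rewrite Z. assert (psi 0 <= psi b); [|lra].
  apply derive_nonneg_incr with (df := dpsi); auto.
  intros u Hu. eapply Rle_trans; [apply Cmod_ge_0|apply Hle; exact Hu].
Qed.

Lemma is_series_C (u : nat -> C) (x y : R) :
  is_series (fun n => Re (u n)) x -> is_series (fun n => Im (u n)) y ->
  is_series (K := C_AbsRing) (V := C_NormedModule) u (x, y).
Proof.
  intros Hx Hy.
  assert (E : forall n, sum_n (G := C_NormedModule) u n =
     (sum_n (fun n => Re (u n)) n, sum_n (fun n => Im (u n)) n)).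
  { induction n as [|n IH].
    - rewrite !sum_O. apply surjective_pairing.
    - rewrite !sum_Sn, IH. reflexivity. }
  unfold is_series in *.
  apply (filterlim_ext (fun n => (sum_n (fun n => Re (u n)) n, sum_n (fun n => Im (u n)) n))).
  { intros n. symmetry. apply E. }
  intros P [e HP]. unfold filtermap.
  assert (Kx := Hx _ (locally_ball x e)). assert (Ky := Hy _ (locally_ball y e)).
  unfold filtermap in Kx, Ky. generalize (filter_and _ _ Kx Ky). apply filter_imp.
  intros n [H1 H2]. apply HP.
  split; [exact H1|exact H2].
Qed.

Notation is_cseries := (is_series (K := C_AbsRing) (V := C_NormedModule)).

Lemma is_cseries_unique (u : nat -> C) (l m : C) :
  is_cseries u l -> is_cseries u m -> l = m.
Proof. intros H1 H2. exact (filterlim_locally_unique _ _ _ H1 H2). Qed.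

Lemma Cmod_series_le (u : nat -> C) (v : nat -> R) (l : C) (M : R) :
  is_cseries u l -> is_series v M -> (forall n, Cmod (u n) <= v n) -> Cmod l <= M.
Proof.
  intros Hu Hv Hle.
  assert (H1 : is_lim_seq (fun n => Cmod (sum_n (G := C_NormedModule) u n)) (Cmod l)).
  { unfold is_lim_seq.
    exact (filterlim_comp _ _ _ _ _ _ _ _ Hu (filterlim_norm (V := C_NormedModule) l)). }
  assert (H2 : is_lim_seq (sum_n v) M) by exact Hv.
  refine (is_lim_seq_le _ _ _ _ _ H1 H2).
  induction n as [|n IH]; [rewrite !sum_O; apply Hle|].
  rewrite !sum_Sn. eapply Rle_trans; [apply Cmod_triangle|].
  apply Rplus_le_compat; [exact IH|apply Hle].
Qed.

(** * Complex power series with real coefficients *)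

(** Absolute convergence in the whole open disk. *)
Definition disk_summable (a : nat -> R) : Prop :=
  forall t, 0 <= t < 1 -> ex_series (fun n => Rabs (a n) * t ^ n).

(** The real and imaginary parts are summed separately, so that theorems on real
    series, in particular on Cauchy products, apply to them. *)
Definition cps (a : nat -> R) (z : C) : C :=
  (Series (fun n => a n * Re (z ^ n)%C), Series (fun n => a n * Im (z ^ n)%C)).

Lemma RtoC_Rmult_Re (a : R) (w : C) : Re (RtoC a * w)%C = a * Re w.
Proof. destruct w; unfold Re, Cmult, RtoC; simpl; ring. Qed.

Lemma RtoC_Rmult_Im (a : R) (w : C) : Im (RtoC a * w)%C = a * Im w.
Proof. destruct w; unfold Im, Cmult, RtoC; simpl; ring. Qed.

Lemma ex_series_Rle (u v : nat -> R) :
  (forall n, Rabs (u n) <= v n) -> ex_series v -> ex_series u.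
Proof. intros H Hv. apply (ex_series_le (V := R_CompleteNormedModule) u v); assumption. Qed.

Section abs_components.
Variables (a : nat -> R) (z : C).
Hypotheses (Ha : disk_summable a) (Hz : Cmod z < 1).

Lemma ex_series_Cmod_pow : ex_series (fun n => Rabs (a n) * Cmod z ^ n).
Proof. apply Ha. split; [apply Cmod_ge_0|exact Hz]. Qed.

Lemma ex_series_abs_Re : ex_series (fun n => Rabs (a n * Re (z ^ n)%C)).
Proof.
  refine (ex_series_Rle _ _ _ ex_series_Cmod_pow). intros n.
  rewrite Rabs_Rabsolu, Rabs_mult, <- Cmod_pow.
  apply Rmult_le_compat_l; [apply Rabs_pos|apply Re_le_Cmod].
Qed.

Lemma ex_series_abs_Im : ex_series (fun n => Rabs (a n * Im (z ^ n)%C)).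
Proof.
  refine (ex_series_Rle _ _ _ ex_series_Cmod_pow). intros n.
  rewrite Rabs_Rabsolu, Rabs_mult, <- Cmod_pow.
  apply Rmult_le_compat_l; [apply Rabs_pos|apply Im_le_Cmod].
Qed.

Lemma cps_is_series : is_cseries (fun n => RtoC (a n) * z ^ n)%C (cps a z).
Proof.
  apply is_series_C.
  - apply (is_series_ext (fun n => a n * Re (z ^ n)%C)).
    { intros n. symmetry. apply RtoC_Rmult_Re. }
    apply Series_correct, ex_series_Rabs, ex_series_abs_Re.
  - apply (is_series_ext (fun n => a n * Im (z ^ n)%C)).
    { intros n. symmetry. apply RtoC_Rmult_Im. }
    apply Series_correct, ex_series_Rabs, ex_series_abs_Im.
Qed.

Lemma cps_eq (l : C) : is_cseries (fun n => RtoC (a n) * z ^ n)%C l -> cps a z = l.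
Proof. intros H. exact (is_cseries_unique _ _ _ cps_is_series H). Qed.

Lemma Cmod_cps_le : Cmod (cps a z) <= Series (fun n => Rabs (a n) * Cmod z ^ n).
Proof.
  apply (Cmod_series_le _ _ _ _ cps_is_series (Series_correct _ ex_series_Cmod_pow)).
  intros n. rewrite Cmod_mult, Cmod_R, Cmod_pow. apply Rle_refl.
Qed.

Lemma cps_is_pseries :
  @is_pseries C_AbsRing C_NormedModule (fun n => RtoC (a n)) z (cps a z).
Proof.
  unfold is_pseries.
  refine (is_series_ext (V := C_NormedModule) _ _ _ _ cps_is_series).
  intros n.
  assert (E : pow_n (K := C_AbsRing) z n = (z ^ n)%C).
  { induction n as [|n IH]; [reflexivity|]. simpl. rewrite IH. reflexivity. }
  rewrite E. apply Cmult_comm.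
Qed.
End abs_components.

(** Brings in the invariance of the radius of convergence under differentiation
    and shifts. *)
Lemma disk_summable_CV_radius (a : nat -> R) :
  disk_summable a <-> Rbar_le 1 (CV_radius a).
Proof.
  split.
  - intros Ha. apply Rbar_not_lt_le. intros Hlt.
    assert (H0 := CV_radius_ge_0 a). destruct (Lub_Rbar_correct (CV_disk a)) as [Hub _].
    fold (CV_radius a) in Hub.
    destruct (CV_radius a) as [c| |] eqn:E; simpl in *; try easy.
    assert (Hc : Rbar_le (Finite ((1 + c) / 2)) (Finite c)); [|simpl in Hc; lra].
    apply Hub. unfold CV_disk.
    apply (ex_series_ext (fun n => Rabs (a n) * ((1 + c) / 2) ^ n)).
    { intros n. rewrite Rabs_mult, (Rabs_pos_eq (_ ^ n)); [reflexivity|].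
      apply pow_le; lra. }
    apply Ha; lra.
  - intros H t Ht.
    apply (ex_series_ext (fun n => Rabs (a n * t ^ n))).
    { intros n. rewrite Rabs_mult, (Rabs_pos_eq (t ^ n)); [reflexivity|].
      apply pow_le; lra. }
    apply CV_disk_inside. rewrite Rabs_pos_eq by lra.
    eapply Rbar_lt_le_trans; [|exact H]. simpl; lra.
Qed.

Lemma disk_summable_bounded (a : nat -> R) (M : R) :
  (forall n, Rabs (a n) <= M) -> disk_summable a.
Proof.
  intros H. apply disk_summable_CV_radius. apply (CV_radius_bounded a).
  exists M. intros n. rewrite pow1, Rmult_1_r. apply H.
Qed.

Lemma disk_summable_derive (a : nat -> R) : disk_summable a -> disk_summable (PS_derive a).
Proof. rewrite !disk_summable_CV_radius, CV_radius_derive. auto. Qed.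

Lemma disk_summable_incr (a : nat -> R) : disk_summable a -> disk_summable (PS_incr_1 a).
Proof. rewrite !disk_summable_CV_radius, CV_radius_incr_1. auto. Qed.

Lemma disk_summable_ext (a b : nat -> R) :
  (forall n, a n = b n) -> disk_summable a -> disk_summable b.
Proof. intros E. rewrite !disk_summable_CV_radius, (CV_radius_ext a b E). auto. Qed.

Lemma disk_summable_mul_n (a : nat -> R) :
  disk_summable a -> disk_summable (fun n => INR n * a n).
Proof.
  intros H. apply (disk_summable_ext (PS_incr_1 (PS_derive a))).
  - intros [|n]; [simpl; unfold zero; simpl; ring|reflexivity].
  - apply disk_summable_incr, disk_summable_derive, H.
Qed.

Lemma disk_summable_mult (a b : nat -> R) :
  disk_summable a -> disk_summable b -> disk_summable (PS_mult a b).
Proof.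
  intros Ha Hb t Ht.
  assert (Habs : forall c, disk_summable c ->
    ex_series (fun n => Rabs (Rabs (c n) * t ^ n))).
  { intros c Hc. apply (ex_series_ext (fun n => Rabs (c n) * t ^ n)); [|apply Hc, Ht].
    intros n. symmetry. apply Rabs_pos_eq, Rmult_le_pos; [apply Rabs_pos|apply pow_le; lra]. }
  destruct (Ha t Ht) as [la Hla]. destruct (Hb t Ht) as [lb Hlb].
  assert (K := is_series_mult _ _ _ _ Hla Hlb (Habs a Ha) (Habs b Hb)).
  refine (ex_series_Rle _ _ _ (ex_intro _ _ K)).
  intros n. simpl. rewrite Rabs_mult, Rabs_Rabsolu, (Rabs_pos_eq (t ^ n)) by (apply pow_le; lra).
  apply Rle_trans with (sum_f_R0 (fun k => Rabs (a k * b (n - k)%nat)) n * t ^ n).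
  - apply Rmult_le_compat_r; [apply pow_le; lra|apply Rsum_abs].
  - right. rewrite Rmult_comm, scal_sum. apply sum_eq. intros k Hk.
    rewrite Rabs_mult. replace (t ^ n) with (t ^ k * t ^ (n - k)); [ring|].
    rewrite <- pow_add. f_equal. lia.
Qed.

(** Mertens' theorem, applied to the four products of real and imaginary parts. *)
Lemma cps_mult (a b : nat -> R) (z : C) :
  disk_summable a -> disk_summable b -> Cmod z < 1 ->
  cps (PS_mult a b) z = (cps a z * cps b z)%C.
Proof.
  intros Ha Hb Hz.
  assert (S : forall x, ex_series (fun n => Rabs (x n)) -> is_series x (Series x)).
  { intros x Hx. apply Series_correct, ex_series_Rabs, Hx. }
  assert (HaR := ex_series_abs_Re a z Ha Hz). assert (HaI := ex_series_abs_Im a z Ha Hz).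
  assert (HbR := ex_series_abs_Re b z Hb Hz). assert (HbI := ex_series_abs_Im b z Hb Hz).
  assert (RR := is_series_mult _ _ _ _ (S _ HaR) (S _ HbR) HaR HbR).
  assert (II := is_series_mult _ _ _ _ (S _ HaI) (S _ HbI) HaI HbI).
  assert (RI := is_series_mult _ _ _ _ (S _ HaR) (S _ HbI) HaR HbI).
  assert (IR := is_series_mult _ _ _ _ (S _ HaI) (S _ HbR) HaI HbR).
  assert (Epow : forall n k, (k <= n)%nat -> (z ^ n = z ^ k * z ^ (n - k))%C).
  { intros n k Hk. rewrite <- Cpow_add_r. f_equal. lia. }
  unfold cps at 1. unfold Cmult. f_equal.
  - apply is_series_unique.
    refine (is_series_ext _ _ _ _ (is_series_minus _ _ _ _ RR II)).
    intros n. unfold PS_mult. rewrite Rmult_comm, scal_sum.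
    change (plus ?p (opp ?q)) with (p - q). rewrite <- minus_sum.
    apply sum_eq. intros k Hk. rewrite (Epow n k Hk).
    unfold Re, Im, Cmult; simpl. ring.
  - apply is_series_unique.
    refine (is_series_ext _ _ _ _ (is_series_plus _ _ _ _ RI IR)).
    intros n. unfold PS_mult. rewrite Rmult_comm, scal_sum.
    change (plus ?p ?q) with (p + q). rewrite <- plus_sum.
    apply sum_eq. intros k Hk. rewrite (Epow n k Hk).
    unfold Re, Im, Cmult; simpl. ring.
Qed.

Lemma is_cseries_decr (u : nat -> C) (l : C) :
  u 0%nat = RtoC 0 -> is_cseries (fun n => u (S n)) l -> is_cseries u l.
Proof.
  intros H0 H. apply (is_series_decr_1 (V := C_NormedModule)). rewrite H0.
  replace (plus (G := C_NormedModule) l (opp (RtoC 0 : C_NormedModule))) with l; [exact H|].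
  change (l = (l - RtoC 0)%C). ring.
Qed.

Lemma is_cseries_scal (c : C) (u : nat -> C) (l : C) :
  is_cseries u l -> is_cseries (fun n => c * u n)%C (c * l)%C.
Proof. exact (is_series_scal (K := C_AbsRing) (V := C_NormedModule) c u l). Qed.

Lemma is_cseries_minus (u v : nat -> C) (l m : C) :
  is_cseries u l -> is_cseries v m -> is_cseries (fun n => u n - v n)%C (l - m)%C.
Proof. exact (is_series_minus (K := C_AbsRing) (V := C_NormedModule) u v l m). Qed.

Lemma disk_summable_decr (a : nat -> R) : disk_summable a -> disk_summable (PS_decr_1 a).
Proof. rewrite !disk_summable_CV_radius, CV_radius_decr_1. auto. Qed.

Lemma cps_decr (a : nat -> R) (z : C) :
  disk_summable a -> Cmod z < 1 ->
  cps a z = (RtoC (a 0%nat) + z * cps (PS_decr_1 a) z)%C.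
Proof.
  intros Ha Hz. assert (Hd := disk_summable_decr a Ha).
  apply cps_eq; [exact Ha|exact Hz|].
  apply (is_series_decr_1 (V := C_NormedModule)).
  match goal with |- is_series _ ?l =>
    replace l with (z * cps (PS_decr_1 a) z)%C end.
  2:{ match goal with |- ?A = _ =>
        change (A = RtoC (a 0%nat) + A - RtoC (a 0%nat) * 1)%C end. ring. }
  refine (is_series_ext (V := C_NormedModule) _ _ _ _
     (is_cseries_scal z _ _ (cps_is_series _ z Hd Hz))).
  intros n. unfold PS_decr_1. rewrite Cpow_S.
  match goal with |- ?A = ?B => change (@eq C A B) end. ring.
Qed.

Lemma cps_ext (a b : nat -> R) (z : C) : (forall n, a n = b n) -> cps a z = cps b z.
Proof. intros E. unfold cps. f_equal; apply Series_ext; intros n; rewrite E; reflexivity. Qed.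

Lemma cps_incr (a : nat -> R) (z : C) :
  disk_summable a -> Cmod z < 1 -> cps (PS_incr_1 a) z = (z * cps a z)%C.
Proof.
  intros Ha Hz. rewrite (cps_decr _ z (disk_summable_incr a Ha) Hz).
  change (PS_incr_1 a 0) with 0. apply Cplus_0_l.
Qed.

Lemma cps_scal (c : R) (a : nat -> R) (z : C) :
  cps (fun n => c * a n) z = (RtoC c * cps a z)%C.
Proof.
  unfold cps, Cmult, RtoC; simpl. rewrite !Rmult_0_l, Rminus_0_r, Rplus_0_r, <- !Series_scal_l.
  f_equal; apply Series_ext; intros n; apply Rmult_assoc.
Qed.

Lemma disk_summable_plus (a b : nat -> R) :
  disk_summable a -> disk_summable b -> disk_summable (fun n => a n + b n).
Proof.
  intros Ha Hb t Ht.
  refine (ex_series_Rle _ _ _ (ex_series_plus _ _ (Ha t Ht) (Hb t Ht))). intros n.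
  change (plus ?p ?q) with (p + q).
  rewrite Rabs_mult, Rabs_Rabsolu, (Rabs_pos_eq (t ^ n)) by (apply pow_le; lra).
  rewrite <- Rmult_plus_distr_r. apply Rmult_le_compat_r; [apply pow_le; lra|apply Rabs_triang].
Qed.

Lemma cps_plus (a b : nat -> R) (z : C) :
  disk_summable a -> disk_summable b -> Cmod z < 1 ->
  cps (fun n => a n + b n) z = (cps a z + cps b z)%C.
Proof.
  intros Ha Hb Hz. unfold cps, Cplus; simpl.
  f_equal; rewrite <- Series_plus;
    try (apply ex_series_Rabs; first [apply ex_series_abs_Re|apply ex_series_abs_Im]; assumption);
    apply Series_ext; intros n; ring.
Qed.

Lemma cps_at_0 (a : nat -> R) : disk_summable a -> cps a 0 = RtoC (a 0%nat).
Proof.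
  intros Ha. rewrite (cps_decr a 0 Ha) by (rewrite Cmod_0; lra). ring.
Qed.

(** The remainder E_n satisfies E_(n+1) = y E_n + n z^(n-1) (y - z)^2.  The factor
    R * R on the left stands for the exponent n - 2 on the right. *)
Lemma pow_taylor_bound (R : R) (z y : C) (n : nat) :
  0 < R -> Cmod z <= R -> Cmod y <= R ->
  R * R * Cmod (y ^ n - z ^ n - RtoC (INR n) * z ^ (pred n) * (y - z))
  <= INR n * INR n * R ^ n * (Cmod (y - z) * Cmod (y - z)).
Proof.
  intros HR Hz Hy. set (D := Cmod (y - z)). assert (HD : 0 <= D) by apply Cmod_ge_0.
  induction n as [|n IH].
  - simpl. replace (1 - 1 - RtoC 0 * 1 * (y - z))%C with (RtoC 0) by ring.
    rewrite Cmod_0. lra.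
  - replace (y ^ S n - z ^ S n - RtoC (INR (S n)) * z ^ pred (S n) * (y - z))%C
      with (y * (y ^ n - z ^ n - RtoC (INR n) * z ^ pred n * (y - z))
            + RtoC (INR n) * z ^ pred n * ((y - z) * (y - z)))%C.
    2:{ rewrite S_INR, RtoC_plus. destruct n as [|n]; simpl; ring. }
    set (E := (y ^ n - z ^ n - RtoC (INR n) * z ^ pred n * (y - z))%C) in *.
    assert (HE := Cmod_ge_0 E). assert (Hn := pos_INR n).
    assert (HRn : 0 < R ^ n) by (apply pow_lt; exact HR).
    assert (T : R * Cmod (RtoC (INR n) * z ^ pred n * ((y - z) * (y - z)))
                <= INR n * R ^ n * (D * D)).
    { rewrite !Cmod_mult, Cmod_R, Cmod_pow, (Rabs_pos_eq (INR n) Hn). fold D.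
      destruct n as [|n]; [simpl; lra|].
      simpl pred. rewrite <- tech_pow_Rmult.
      assert (Cmod z ^ n <= R ^ n) by (apply pow_incr; split; [apply Cmod_ge_0|exact Hz]).
      assert (0 <= INR (S n) * (D * D) * R) by (repeat apply Rmult_le_pos; lra). nra. }
    apply Rle_trans with (R * R * (Cmod y * Cmod E
      + Cmod (RtoC (INR n) * z ^ pred n * ((y - z) * (y - z))))).
    { apply Rmult_le_compat_l; [nra|]. rewrite <- Cmod_mult. apply Cmod_triangle. }
    assert (P : R * R * (Cmod y * Cmod E) <= R * (INR n * INR n * R ^ n * (D * D))).
    { apply Rle_trans with (R * (R * R * Cmod E)).
      - assert (0 <= R * R * Cmod E) by (apply Rmult_le_pos; nra). nra.
      - apply Rmult_le_compat_l; lra. }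
    rewrite <- tech_pow_Rmult, S_INR.
    assert (Q : 0 <= R ^ n * (D * D)) by (apply Rmult_le_pos; nra).
    assert (Q' : 0 <= R * (R ^ n * (D * D))) by (apply Rmult_le_pos; lra).
    assert (0 <= INR n * (R * (R ^ n * (D * D)))) by (apply Rmult_le_pos; lra).
    nra.
Qed.

(** The termwise remainders of second order add up to a multiple of |y - z|^2,
    because n^2 a_n is still summable on the disk. *)
Lemma cps_derive (a : nat -> R) (z : C) :
  disk_summable a -> Cmod z < 1 -> has_cderiv (cps a) z (cps (PS_derive a) z).
Proof.
  intros Ha Hz. assert (Hz0 := Cmod_ge_0 z).
  (* A radius strictly between |z| and 1, on which the second order bound is uniform. *)
  set (r := (1 + Cmod z) / 2).
  assert (Hr : 0 < r < 1) by (unfold r; lra).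
  assert (Hs : ex_series (fun n => Rabs (INR n * (INR n * a n)) * r ^ n)).
  { apply (disk_summable_mul_n _ (disk_summable_mul_n _ Ha)). lra. }
  set (K := Series (fun n => Rabs (INR n * (INR n * a n)) * r ^ n)).
  assert (HK : is_series (fun n => Rabs (INR n * (INR n * a n)) * r ^ n) K)
    by (apply Series_correct; exact Hs).
  assert (Hbound : forall y, Cmod (y - z) < r - Cmod z ->
    Cmod (cps a y - cps a z - (y - z) * cps (PS_derive a) z)
    <= K / (r * r) * (Cmod (y - z) * Cmod (y - z))).
  { intros y Hy.
    assert (Hyr : Cmod y <= r).
    { replace y with (z + (y - z))%C by ring. pose proof (Cmod_triangle z (y - z)). lra. }
    assert (S1 := cps_is_series a y Ha ltac:(lra)).
    assert (S2 := cps_is_series a z Ha Hz).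
    assert (S3 : is_cseries (fun n => RtoC (INR n * a n) * z ^ pred n)%C (cps (PS_derive a) z)).
    { apply is_cseries_decr; [simpl; rewrite Rmult_0_l; ring|].
      exact (cps_is_series (PS_derive a) z (disk_summable_derive a Ha) Hz). }
    assert (S4 := is_cseries_minus _ _ _ _ (is_cseries_minus _ _ _ _ S1 S2)
                    (is_cseries_scal (y - z)%C _ _ S3)).
    set (D := Cmod (y - z)) in *.
    assert (S5 := is_series_scal (V := R_NormedModule) (D * D / (r * r)) _ _ HK).
    replace (K / (r * r) * (D * D)) with (D * D / (r * r) * K) by (field; lra).
    apply (Cmod_series_le _ _ _ _ S4 S5). intros n. simpl.
    replace (RtoC (a n) * y ^ n - RtoC (a n) * z ^ n
             - (y - z) * (RtoC (INR n * a n) * z ^ pred n))%C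
      with (RtoC (a n) * (y ^ n - z ^ n - RtoC (INR n) * z ^ pred n * (y - z)))%C
      by (rewrite RtoC_mult; ring).
    rewrite Cmod_mult, Cmod_R.
    assert (T := pow_taylor_bound r z y n (proj1 Hr) ltac:(unfold r; lra) Hyr). fold D in T.
    rewrite !Rabs_mult, (Rabs_pos_eq (INR n)) by apply pos_INR.
    change (scal ?p ?q) with (p * q).
    set (X := Cmod (y ^ n - z ^ n - RtoC (INR n) * z ^ pred n * (y - z))) in *.
    assert (X <= INR n * INR n * r ^ n * (D * D) / (r * r)).
    { apply Rmult_le_reg_l with (r * r); [nra|].
      replace (r * r * (INR n * INR n * r ^ n * (D * D) / (r * r)))
        with (INR n * INR n * r ^ n * (D * D)) by (field; lra). exact T. }
    replace (D * D / (r * r) * (INR n * (INR n * Rabs (a n)) * r ^ n))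
      with (Rabs (a n) * (INR n * INR n * r ^ n * (D * D) / (r * r))) by (field; lra).
    apply Rmult_le_compat_l; [apply Rabs_pos|assumption]. }
  assert (HK0 : 0 <= K).
  { apply Rle_trans with (Cmod (cps (fun n => INR n * (INR n * a n)) (RtoC r))).
    - apply Cmod_ge_0.
    - eapply Rle_trans; [apply Cmod_cps_le|].
      + apply disk_summable_mul_n, disk_summable_mul_n, Ha.
      + rewrite Cmod_R, Rabs_pos_eq; lra.
      + rewrite Cmod_R, Rabs_pos_eq by lra. apply Rle_refl. }
  refine (has_cderiv_quadratic _ _ _ (r - Cmod z) (K / (r * r)) _ _ Hbound).
  - unfold r; lra.
  - apply Rmult_le_pos; [exact HK0|]. apply Rlt_le, Rinv_0_lt_compat. nra.
Qed.

(** * A lacunary Bloch function and its exponential *)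

Definition is_pow4 (n : nat) : bool := existsb (fun k => Nat.eqb (4 ^ k) n) (seq 0 (S n)).

Lemma is_pow4_true (k : nat) : is_pow4 (4 ^ k) = true.
Proof.
  apply existsb_exists. exists k. split.
  - apply in_seq. assert (k < 4 ^ k)%nat by (apply Nat.pow_gt_lin_r; lia). lia.
  - apply Nat.eqb_refl.
Qed.

Lemma is_pow4_false (K n : nat) : (4 ^ K < n < 4 ^ S K)%nat -> is_pow4 n = false.
Proof.
  intros H. apply Bool.not_true_iff_false. intros E.
  apply existsb_exists in E. destruct E as [k [_ Hk]]. apply Nat.eqb_eq in Hk. subst n.
  destruct H as [H1 H2].
  apply Nat.pow_lt_mono_r_iff in H1; [|lia]. apply Nat.pow_lt_mono_r_iff in H2; lia.
Qed.

(** The monoid is arbitrary because the statement serves both real weights and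
    complex powers. *)
Lemma sum_pow4 {G : AbelianMonoid} (g : nat -> G) (N K : nat) :
  (4 ^ K <= N < 4 ^ S K)%nat ->
  sum_n (fun n => if is_pow4 n then g n else zero) N = sum_n (fun k => g (4 ^ k)%nat) K.
Proof.
  revert K. induction N as [|N IH]; intros K HK.
  - assert (4 ^ K <> 0)%nat by (apply Nat.pow_nonzero; lia). lia.
  - rewrite sum_Sn. destruct (Nat.eq_dec (S N) (4 ^ K)) as [E|NE].
    + rewrite E, is_pow4_true. destruct K as [|K].
      * simpl in E. injection E as ->. rewrite !sum_O. apply plus_zero_l.
      * rewrite sum_Sn. f_equal. apply IH.
        assert (4 ^ K <> 0)%nat by (apply Nat.pow_nonzero; lia).
        rewrite Nat.pow_succ_r' in *. lia.
    + rewrite (is_pow4_false K) by lia. rewrite plus_zero_r. apply IH. lia.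
Qed.

Lemma pow4_bracket (N : nat) : (0 < N)%nat -> exists K, (4 ^ K <= N < 4 ^ S K)%nat.
Proof.
  induction N as [|N IH]; [lia|]. intros _.
  destruct (Nat.eq_dec N 0) as [->|HN]; [exists 0%nat; simpl; lia|].
  destruct IH as [K HK]; [lia|].
  destruct (Nat.eq_dec (S N) (4 ^ S K)) as [E|NE].
  - exists (S K). rewrite (Nat.pow_succ_r' 4 (S K)). lia.
  - exists K. lia.
Qed.

Definition lac (n : nat) : R := if is_pow4 n then 1 else 0.

Lemma lac_bound (n : nat) : 0 <= lac n <= 1.
Proof. unfold lac. destruct (is_pow4 n); lra. Qed.

Lemma lac_summable : disk_summable lac.
Proof.
  apply disk_summable_bounded with 1. intros n. pose proof (lac_bound n).
  rewrite Rabs_pos_eq; lra.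
Qed.

(** The powers of 4 up to N form a geometric sum, at most twice its last term.
    This linear growth is the Bloch property of the lacunary series. *)
Lemma lac_weighted_sum (N : nat) : sum_f_R0 (fun n => INR n * lac n) N <= 2 * INR N.
Proof.
  destruct (Nat.eq_dec N 0) as [->|HN]; [simpl; unfold lac; simpl; lra|].
  destruct (pow4_bracket N) as [K HK]; [lia|].
  rewrite <- sum_n_Reals.
  rewrite (sum_n_ext _ (fun n => if is_pow4 n then INR n else zero)).
  2:{ intros n. unfold lac, zero; simpl. destruct (is_pow4 n); ring. }
  rewrite (sum_pow4 INR N K HK).
  apply Rle_trans with (2 * INR (4 ^ K)).
  - clear. induction K as [|K IH]; [rewrite sum_O; simpl; lra|].
    rewrite sum_Sn. change (plus ?p ?q) with (p + q).
    rewrite Nat.pow_succ_r', mult_INR. simpl (INR 4).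
    assert (0 <= INR (4 ^ K)) by apply pos_INR. lra.
  - apply Rmult_le_compat_l; [lra|]. apply le_INR. lia.
Qed.

(** The partial sums over n <= 4^K of the power series are the partial sums over
    k <= K of this series. *)
Lemma cps_lac_series (z : C) :
  Cmod z < 1 -> is_cseries (fun k => z ^ (4 ^ k))%C (cps lac z).
Proof.
  intros Hz. assert (H := cps_is_series lac z lac_summable Hz).
  unfold is_series in *.
  assert (Hphi : filterlim (fun K => (4 ^ K)%nat) eventually eventually).
  { apply eventually_subseq. intros n. apply Nat.pow_lt_mono_r; lia. }
  assert (H2 := filterlim_comp _ _ _ _ _ _ _ _ Hphi H).
  refine (filterlim_ext _ _ _ H2). intros K. cbv beta.
  rewrite <- (sum_pow4 (G := C_NormedModule) (fun n => z ^ n)%C (4 ^ K) K).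
  2:{ rewrite Nat.pow_succ_r'. assert (4 ^ K <> 0)%nat by (apply Nat.pow_nonzero; lia). lia. }
  apply (sum_n_ext (G := C_NormedModule)). intros n. unfold lac.
  destruct (is_pow4 n).
  - change (RtoC 1 * z ^ n = z ^ n)%C. ring.
  - change (RtoC 0 * z ^ n = RtoC 0)%C. ring.
Qed.

Lemma Cmod_pow4_lt (z : C) : Cmod z < 1 -> Cmod (z ^ 4) < 1.
Proof.
  intros Hz. rewrite Cmod_pow. assert (H := Cmod_ge_0 z).
  assert (Cmod z * Cmod z < 1) by nra. simpl. nra.
Qed.

(** The self-similarity behind all the moment computations below. *)
Lemma cps_lac_functional (z : C) :
  Cmod z < 1 -> cps lac z = (z + cps lac (z ^ 4))%C.
Proof.
  intros Hz. apply (is_cseries_unique _ _ _ (cps_lac_series z Hz)).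
  apply (is_series_decr_1 (V := C_NormedModule)).
  match goal with |- is_series _ ?l =>
    replace l with (cps lac (z ^ 4))
      by (change (cps lac (z ^ 4) = z + cps lac (z ^ 4) - z ^ (4 ^ 0))%C; simpl; ring) end.
  refine (is_series_ext (V := C_NormedModule) _ _ _ _
            (cps_lac_series _ (Cmod_pow4_lt z Hz))).
  intros k. rewrite <- Cpow_mult_r. rewrite Nat.pow_succ_r'. reflexivity.
Qed.

Lemma cps_lac_small (z : C) : Cmod z < 1 -> Cmod (cps lac z) <= Cmod z / (1 - Cmod z).
Proof.
  intros Hz. assert (H0 := Cmod_ge_0 z).
  assert (G : is_series (fun k => Cmod z * Cmod z ^ k) (Cmod z * / (1 - Cmod z))).
  { apply (is_series_scal (V := R_NormedModule) (Cmod z)). apply is_series_geom.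
    rewrite Rabs_pos_eq; lra. }
  refine (Cmod_series_le _ _ _ _ (cps_lac_series z Hz) G _).
  intros k. rewrite Cmod_pow. change (Cmod z * Cmod z ^ k) with (Cmod z ^ S k).
  assert (k < 4 ^ k)%nat by (apply Nat.pow_gt_lin_r; lia).
  replace (4 ^ k)%nat with (S k + (4 ^ k - S k))%nat by lia.
  rewrite pow_add. rewrite <- (Rmult_1_r (Cmod z ^ S k)) at 2.
  apply Rmult_le_compat_l; [apply pow_le; lra|].
  rewrite <- (pow1 (4 ^ k - S k)). apply pow_incr. lra.
Qed.

(** Summation by parts.  For x in [0, 1] the difference of the two weighted sums is
    at least x^N times the difference of the unweighted ones, and this is preserved
    from N to N + 1. *)
Lemma abel_compare (p q : nat -> R) (x : R) (N : nat) :
  0 <= x <= 1 -> (forall n, sum_f_R0 p n <= sum_f_R0 q n) ->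
  sum_f_R0 (fun n => p n * x ^ n) N <= sum_f_R0 (fun n => q n * x ^ n) N.
Proof.
  intros Hx H.
  assert (K : x ^ N * (sum_f_R0 q N - sum_f_R0 p N)
              <= sum_f_R0 (fun n => q n * x ^ n) N - sum_f_R0 (fun n => p n * x ^ n) N).
  { induction N as [|N IH]; [simpl; lra|].
    rewrite !tech5, <- tech_pow_Rmult. specialize (H N).
    assert (0 <= x ^ N) by (apply pow_le; lra).
    assert (0 <= x ^ N * (sum_f_R0 q N - sum_f_R0 p N)) by (apply Rmult_le_pos; lra).
    nra. }
  assert (0 <= x ^ N) by (apply pow_le; lra). specialize (H N).
  assert (0 <= x ^ N * (sum_f_R0 q N - sum_f_R0 p N)) by (apply Rmult_le_pos; lra).
  lra.
Qed.

(** Partial sums of order c n make the series comparable with the one whose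
    coefficients are all equal to c. *)
Lemma cps_growth (p : nat -> R) (c : R) (z : C) :
  (forall n, 0 <= p n) -> disk_summable p ->
  (forall n, sum_f_R0 p n <= c * INR (S n)) -> Cmod z < 1 ->
  Cmod (cps p z) <= c / (1 - Cmod z).
Proof.
  intros Hp Hs Hc Hz. assert (H0 := Cmod_ge_0 z). set (x := Cmod z) in *.
  eapply Rle_trans; [apply (Cmod_cps_le p z Hs Hz)|]. fold x.
  assert (S1 : is_series (fun n => Rabs (p n) * x ^ n) (Series (fun n => Rabs (p n) * x ^ n))).
  { apply Series_correct, Hs. lra. }
  assert (S2 : is_series (fun n => c * x ^ n) (c * / (1 - x))).
  { apply (is_series_scal (V := R_NormedModule) c). apply is_series_geom.
    rewrite Rabs_pos_eq; lra. }
  refine (is_lim_seq_le _ _ (Finite _) (Finite _) _ S1 S2). intros n.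
  rewrite !sum_n_Reals.
  rewrite (sum_eq _ (fun n => p n * x ^ n)) by (intros; rewrite Rabs_pos_eq; auto).
  apply (abel_compare p (fun _ => c)); [lra|]. intros m. rewrite sum_cte. apply Hc.
Qed.

(** Stage n is correct at the indices up to n; the detour encodes a recursion on
    all smaller values. *)
Fixpoint exp_coef_upto (p : nat -> R) (n : nat) : nat -> R :=
  match n with
  | 0%nat => fun _ => 1
  | S m => fun k => if Nat.leb k m then exp_coef_upto p m k
                    else PS_mult p (exp_coef_upto p m) m / INR (S m)
  end.

(** The Taylor coefficients at 0 of exp P, where P' has coefficients p and
    P(0) = 0, that is, of the solution of G' = P' G with G(0) = 1. *)
Definition exp_coef (p : nat -> R) (n : nat) : R := exp_coef_upto p n n.

Lemma exp_coef_upto_eq (p : nat -> R) (n k : nat) :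
  (k <= n)%nat -> exp_coef_upto p n k = exp_coef p k.
Proof.
  induction n as [|n IH]; intros Hk.
  - replace k with 0%nat by lia. reflexivity.
  - destruct (Nat.eq_dec k (S n)) as [->|Hne]; [reflexivity|].
    simpl. rewrite (proj2 (Nat.leb_le k n)) by lia. apply IH. lia.
Qed.

Lemma exp_coef_rec (p : nat -> R) (n : nat) :
  PS_derive (exp_coef p) n = PS_mult p (exp_coef p) n.
Proof.
  unfold PS_derive, exp_coef at 1. cbn [exp_coef_upto].
  rewrite (proj2 (Nat.leb_gt (S n) n)) by lia.
  transitivity (PS_mult p (exp_coef_upto p n) n).
  - field. apply not_0_INR. lia.
  - apply sum_eq. intros k Hk. rewrite exp_coef_upto_eq by lia. reflexivity.
Qed.

(** (n + 1) b_(n+1) is the sum of the p_j b_(n-j), hence at most the sum of the p_j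
    when the earlier b_i are at most 1. *)
Lemma exp_coef_bound (p : nat -> R) :
  (forall n, 0 <= p n) -> (forall n, sum_f_R0 p n <= INR (S n)) ->
  forall n, 0 <= exp_coef p n <= 1.
Proof.
  intros Hp Hs. induction n as [n IH] using (well_founded_induction Wf_nat.lt_wf).
  destruct n as [|n]; [unfold exp_coef; simpl; lra|].
  assert (E := exp_coef_rec p n). unfold PS_derive, PS_mult in E.
  assert (Hn : 0 < INR (S n)) by (apply lt_0_INR; lia).
  assert (L : 0 <= sum_f_R0 (fun k => p k * exp_coef p (n - k)) n).
  { rewrite <- (Rmult_0_l (INR (S n))), <- (sum_cte 0 n). apply sum_Rle. intros k Hk.
    apply Rmult_le_pos; [apply Hp|apply IH; lia]. }
  assert (U : sum_f_R0 (fun k => p k * exp_coef p (n - k)) n <= INR (S n)).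
  { eapply Rle_trans; [|apply Hs]. apply sum_Rle. intros k Hk.
    rewrite <- (Rmult_1_r (p k)) at 2. apply Rmult_le_compat_l; [apply Hp|apply IH; lia]. }
  split; nra.
Qed.

Lemma weighted_square_derive (x y k : R -> R) (u dx dy dk : R) :
  is_derive x u dx -> is_derive y u dy -> is_derive k u dk ->
  is_derive (fun t => (x t * x t + y t * y t) * exp (- (2 * k t))) u
    ((2 * x u * dx + 2 * y u * dy) * exp (- (2 * k u))
     + (x u * x u + y u * y u) * (- (2 * dk) * exp (- (2 * k u)))).
Proof.
  intros Hx Hy Hk. auto_derive.
  - repeat split; eexists; eassumption.
  - rewrite (is_derive_unique (fun t : R => x t) u dx Hx), (is_derive_unique (fun t : R => y t) u dy Hy),
      (is_derive_unique (fun t : R => k t) u dk Hk). ring.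
Qed.

(** Since F' / F = L = H', the product F exp (- H) is constant.  Its squared modulus
    |F|^2 exp (- 2 Re H) has zero derivative along the segment. *)
Lemma log_derivative_modulus (F H L : C -> C) (p v : C) :
  (forall u, 0 <= u <= 1 -> has_cderiv F (seg p v u) (F (seg p v u) * L (seg p v u))%C) ->
  (forall u, 0 <= u <= 1 -> has_cderiv H (seg p v u) (L (seg p v u))) ->
  Cmod (F (p + v)%C) * exp (- Re (H (p + v)%C)) = Cmod (F p) * exp (- Re (H p)).
Proof.
  intros HF HH.
  set (x := fun t => Re (F (seg p v t))). set (y := fun t => Im (F (seg p v t))).
  set (k := fun t => Re (H (seg p v t))).
  set (W := fun t => (x t * x t + y t * y t) * exp (- (2 * k t))).
  assert (HW : forall u, 0 <= u <= 1 -> is_derive W u 0).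
  { intros u Hu. destruct (seg_derive F p v _ u (HF u Hu)) as [Hx Hy].
    destruct (seg_derive H p v _ u (HH u Hu)) as [Hk _].
    fold x in Hx. fold y in Hy. fold k in Hk. unfold W.
    replace 0 with ((2 * x u * Re (F (seg p v u) * L (seg p v u) * v)%C
                     + 2 * y u * Im (F (seg p v u) * L (seg p v u) * v)%C) * exp (- (2 * k u))
        + (x u * x u + y u * y u) * (- (2 * Re (L (seg p v u) * v)%C) * exp (- (2 * k u)))).
    - apply weighted_square_derive; assumption.
    - unfold x, y. destruct (F (seg p v u)) as [f1 f2], (L (seg p v u)) as [l1 l2], v as [v1 v2].
      unfold Re, Im, Cmult; simpl. ring. }
  assert (HC : forall u, 0 <= u <= 1 -> continuity_pt W u).
  { intros u Hu. apply derivable_continuous_pt. exists 0. apply is_derive_Reals, HW, Hu. }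
  assert (E : W 0 = W 1).
  { apply Rle_antisym.
    - apply derive_nonneg_incr with (df := fun _ => 0); intros; try lra; [apply HW|apply HC]; lra.
    - apply Ropp_le_cancel.
      apply (derive_nonneg_incr (fun t => - W t) (fun _ => 0)); intros; try lra.
      + replace 0 with (- 0) by ring. apply (is_derive_opp (V := R_NormedModule)). apply HW; lra.
      + apply continuity_pt_opp. apply HC; lra. }
  assert (Esq : forall t, W t = Rsqr (Cmod (F (seg p v t)) * exp (- Re (H (seg p v t))))).
  { intros t. unfold W, x, y, k. rewrite <- Cmod_sq. unfold Rsqr.
    replace (- (2 * Re (H (seg p v t)))) with (- Re (H (seg p v t)) + - Re (H (seg p v t))) by ring.
    rewrite exp_plus. ring. }
  rewrite !Esq in E.
  replace (seg p v 0) with p in E by (unfold seg; ring).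
  replace (seg p v 1) with (p + v)%C in E by (unfold seg; ring).
  symmetry. apply Rsqr_inj; [| |exact E];
    (apply Rmult_le_pos; [apply Cmod_ge_0|apply Rlt_le, exp_pos]).
Qed.

(** The coefficients of eps * (l(z) - z).  Removing the linear term of l keeps the
    second coefficient of the final example unchanged. *)
Definition bloch_coef (eps : R) (n : nat) : R := eps * (if Nat.leb n 1 then 0 else lac n).
Definition bloch (eps : R) : C -> C := cps (bloch_coef eps).
Definition bloch_deriv (eps : R) : C -> C := cps (PS_derive (bloch_coef eps)).
Definition exp_bloch_coef (eps : R) : nat -> R := exp_coef (PS_derive (bloch_coef eps)).
Definition exp_bloch (eps : R) : C -> C := cps (exp_bloch_coef eps).

Section Bloch.
Variable eps : R.
Hypothesis Heps : 0 < eps <= 1 / 2.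

Lemma bloch_coef_bound n : 0 <= bloch_coef eps n <= eps * lac n.
Proof. unfold bloch_coef. pose proof (lac_bound n). destruct (Nat.leb n 1); split; nra. Qed.

Lemma bloch_coef_summable : disk_summable (bloch_coef eps).
Proof.
  apply disk_summable_bounded with eps. intros n.
  pose proof (bloch_coef_bound n). pose proof (lac_bound n). rewrite Rabs_pos_eq; nra.
Qed.

Lemma bloch_deriv_coef_pos n : 0 <= PS_derive (bloch_coef eps) n.
Proof. apply Rmult_le_pos; [apply pos_INR|apply bloch_coef_bound]. Qed.

Lemma bloch_deriv_coef_sum n : sum_f_R0 (PS_derive (bloch_coef eps)) n <= 2 * eps * INR (S n).
Proof.
  apply Rle_trans with (eps * sum_f_R0 (fun k => INR (S k) * lac (S k)) n).
  - rewrite scal_sum. apply sum_Rle. intros k _. unfold PS_derive.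
    pose proof (bloch_coef_bound (S k)). pose proof (pos_INR (S k)). nra.
  - assert (K := lac_weighted_sum (S n)). rewrite decomp_sum in K by lia.
    change (INR 0) with 0 in K. simpl pred in K. nra.
Qed.

Lemma bloch_eq z : Cmod z < 1 -> bloch eps z = (RtoC eps * (cps lac z - z))%C.
Proof.
  intros Hz. unfold bloch.
  assert (Hh := bloch_coef_summable). assert (Hl := lac_summable).
  (* The two coefficient sequences are proportional from index 2 on. *)
  rewrite (cps_decr _ z Hh Hz), (cps_decr _ z (disk_summable_decr _ Hh) Hz).
  rewrite (cps_decr _ z Hl Hz), (cps_decr _ z (disk_summable_decr _ Hl) Hz).
  rewrite (cps_ext (PS_decr_1 (PS_decr_1 (bloch_coef eps)))
             (fun n => eps * PS_decr_1 (PS_decr_1 lac) n)) by reflexivity.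
  rewrite cps_scal.
  change (lac 0) with 0. change (PS_decr_1 lac 0) with 1.
  change (bloch_coef eps 0) with (eps * 0). change (PS_decr_1 (bloch_coef eps) 0) with (eps * 0).
  rewrite Rmult_0_r. ring.
Qed.

Lemma bloch_has_deriv z : Cmod z < 1 -> has_cderiv (bloch eps) z (bloch_deriv eps z).
Proof. apply cps_derive, bloch_coef_summable. Qed.

Lemma bloch_deriv_bound z : Cmod z < 1 -> Cmod (bloch_deriv eps z) <= 2 * eps / (1 - Cmod z).
Proof.
  apply cps_growth.
  - apply bloch_deriv_coef_pos.
  - apply disk_summable_derive, bloch_coef_summable.
  - apply bloch_deriv_coef_sum.
Qed.

Lemma exp_bloch_coef_bound n : 0 <= exp_bloch_coef eps n <= 1.
Proof.
  apply exp_coef_bound; [apply bloch_deriv_coef_pos|].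
  intros m. eapply Rle_trans; [apply bloch_deriv_coef_sum|].
  pose proof (pos_INR (S m)). nra.
Qed.

Lemma exp_bloch_coef_summable : disk_summable (exp_bloch_coef eps).
Proof.
  apply disk_summable_bounded with 1. intros n. pose proof (exp_bloch_coef_bound n).
  rewrite Rabs_pos_eq; lra.
Qed.

Lemma exp_bloch_has_deriv z : Cmod z < 1 -> has_cderiv (exp_bloch eps) z (exp_bloch eps z * bloch_deriv eps z)%C.
Proof.
  intros Hz. unfold exp_bloch, bloch_deriv.
  rewrite Cmult_comm, <- cps_mult;
    [|apply disk_summable_derive, bloch_coef_summable|apply exp_bloch_coef_summable|exact Hz].
  assert (E : cps (PS_mult (PS_derive (bloch_coef eps)) (exp_bloch_coef eps)) z = cps (PS_derive (exp_bloch_coef eps)) z).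
  { apply cps_ext. intros n. symmetry. apply exp_coef_rec. }
  rewrite E. apply cps_derive; [apply exp_bloch_coef_summable|exact Hz].
Qed.

(** Makes exp_bloch play the role of exp (bloch): it has no zero, and its logarithm
    is under control. *)
Lemma exp_bloch_modulus z : Cmod z < 1 -> Cmod (exp_bloch eps z) = exp (Re (bloch eps z)).
Proof.
  intros Hz.
  assert (Hin : forall u, 0 <= u <= 1 -> Cmod (seg 0 z u) < 1).
  { intros u Hu. unfold seg. rewrite Cplus_0_l, Cmod_mult, Cmod_R, Rabs_pos_eq by lra.
    pose proof (Cmod_ge_0 z). nra. }
  assert (E := log_derivative_modulus (exp_bloch eps) (bloch eps) (bloch_deriv eps) 0 z
    (fun u Hu => exp_bloch_has_deriv _ (Hin u Hu)) (fun u Hu => bloch_has_deriv _ (Hin u Hu))).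
  rewrite Cplus_0_l in E.
  assert (G0 : exp_bloch eps 0 = RtoC 1) by apply (cps_at_0 _ exp_bloch_coef_summable).
  assert (H0 : bloch eps 0 = RtoC (eps * 0)) by apply (cps_at_0 _ bloch_coef_summable).
  rewrite G0, H0, Cmod_1 in E. change (Re (RtoC (eps * 0))) with (eps * 0) in E.
  rewrite Rmult_0_r, Ropp_0, exp_0, exp_Ropp in E.
  assert (P := exp_pos (Re (bloch eps z))).
  apply Rmult_eq_reg_r with (/ exp (Re (bloch eps z))); [|apply Rinv_neq_0_compat; lra].
  rewrite E. field. lra.
Qed.
End Bloch.

(** * Small Bloch perturbations of a bi-Lipschitz function *)

(** The midpoint of z and w, pulled towards 0 until its distance to the circle is at
    least |z - w| / 2. *)
Definition apex (z w : C) : C := (RtoC ((1 - Cmod (z - w) / 2) / 2) * (z + w))%C.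

Lemma apex_sym (z w : C) : apex z w = apex w z.
Proof.
  unfold apex. replace (w - z)%C with (- (z - w))%C by ring.
  rewrite Cmod_opp, Cplus_comm. reflexivity.
Qed.

Section Apex.
Variables z w : C.
Hypothesis (Hz : Cmod z < 1) (Hw : Cmod w < 1) (Hne : 0 < Cmod (z - w)).

Lemma Cmod_diff_lt_2 : Cmod (z - w) < 2.
Proof.
  unfold Cminus. eapply Rle_lt_trans; [apply Cmod_triangle|]. rewrite Cmod_opp. lra.
Qed.

Lemma apex_dist : Cmod (z - apex z w) <= Cmod (z - w).
Proof.
  set (s := Cmod (z - w)).
  replace (z - apex z w)%C with (RtoC (/ 2) * (z - w) + RtoC (s / 4) * (z + w))%C.
  2:{ unfold apex. fold s.
      replace ((1 - s / 2) / 2) with (/ 2 - s / 4) by field. rewrite RtoC_minus.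
      replace z with ((RtoC (/ 2) + RtoC (/ 2)) * z)%C at 3; [ring|].
      rewrite <- RtoC_plus. replace (/ 2 + / 2) with 1 by field. ring. }
  eapply Rle_trans; [apply Cmod_triangle|].
  rewrite !Cmod_mult, !Cmod_R. fold s in Hne |- *.
  rewrite (Rabs_pos_eq (/ 2)), (Rabs_pos_eq (s / 4)) by lra.
  pose proof (Cmod_triangle z w). nra.
Qed.

(** The point at parameter u is a convex combination of the apex, of modulus at most
    1 - |z - w| / 2, and of z. *)
Lemma apex_cone u : 0 <= u <= 1 ->
  Cmod (seg (apex z w) (z - apex z w) u)
    <= (1 - u) * (1 - Cmod (z - w) / 2) + u * Cmod z.
Proof.
  intros Hu. set (s := Cmod (z - w)). assert (Hs2 := Cmod_diff_lt_2). fold s in Hs2.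
  replace (seg (apex z w) (z - apex z w) u) with (RtoC (1 - u) * apex z w + RtoC u * z)%C
    by (unfold seg; rewrite RtoC_minus; ring).
  eapply Rle_trans; [apply Cmod_triangle|].
  rewrite !Cmod_mult, !Cmod_R, (Rabs_pos_eq (1 - u)), (Rabs_pos_eq u) by lra.
  apply Rplus_le_compat_r, Rmult_le_compat_l; [lra|].
  unfold apex. fold s. rewrite Cmod_mult, Cmod_R, Rabs_pos_eq by lra.
  pose proof (Cmod_triangle z w). nra.
Qed.

Lemma apex_in_disk u : 0 <= u <= 1 -> Cmod (seg (apex z w) (z - apex z w) u) < 1.
Proof.
  intros Hu. eapply Rle_lt_trans; [apply apex_cone; exact Hu|].
  assert (H2 := Cmod_diff_lt_2). destruct (Req_dec u 1) as [->|H1]; [lra|].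
  assert (0 < (1 - u) * (Cmod (z - w) / 2)) by (apply Rmult_lt_0_compat; lra).
  pose proof (Cmod_ge_0 z). nra.
Qed.

Lemma apex_height u : 0 <= u < 1 ->
  (1 - u) * (Cmod (z - w) / 2) <= 1 - Cmod (seg (apex z w) (z - apex z w) u).
Proof.
  intros Hu. assert (K := apex_cone u ltac:(lra)). nra.
Qed.
End Apex.

(** Abstractly, k is bi-Lipschitz with constants m and M, G plays exp H, c bounds the
    Bloch constant of H, and f' = k' G. *)
Section Perturbation.
Variables (f k G H dk dH : C -> C) (M m c : R).
Hypothesis (Hf : forall z, Cmod z < 1 -> has_cderiv f z (dk z * G z)%C).
Hypothesis (Hk : forall z, Cmod z < 1 -> has_cderiv k z (dk z)).
Hypothesis (HG : forall z, Cmod z < 1 -> has_cderiv G z (G z * dH z)%C).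
Hypothesis (HH : forall z, Cmod z < 1 -> has_cderiv H z (dH z)).
Hypothesis (HGmod : forall z, Cmod z < 1 -> Cmod (G z) = exp (Re (H z))).
Hypothesis (HM : forall z, Cmod z < 1 -> Cmod (dk z) <= M).
Hypothesis (Hm : forall z w, Cmod z < 1 -> Cmod w < 1 -> m * Cmod (z - w) <= Cmod (k z - k w)).
Hypothesis (Hc : 0 < c <= 1 / 4).
Hypothesis (HB : forall z, Cmod z < 1 -> Cmod (dH z) <= c / (1 - Cmod z)).

(** A segment of length at most s along which the distance to the circle stays above
    a linear function that decreases from s / 2 to 0. *)
Section Cone.
Variables (z0 v : C) (s : R).
Hypothesis (Hs : 0 < s) (Hv : Cmod v <= s).
Hypothesis Hin : forall u, 0 <= u <= 1 -> Cmod (seg z0 v u) < 1.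
Hypothesis Hcone : forall u, 0 <= u < 1 -> (1 - u) * (s / 2) <= 1 - Cmod (seg z0 v u).

Lemma cone_dH u : 0 <= u < 1 -> Cmod (dH (seg z0 v u) * v) <= 2 * c / (1 - u).
Proof.
  intros Hu. rewrite Cmod_mult.
  assert (B := HB _ (Hin u ltac:(lra))). assert (K := Hcone u Hu).
  assert (P : 0 < (1 - u) * (s / 2)) by (apply Rmult_lt_0_compat; lra).
  apply Rle_trans with (c / ((1 - u) * (s / 2)) * s).
  - apply Rmult_le_compat; try apply Cmod_ge_0; [|exact Hv].
    eapply Rle_trans; [exact B|]. apply Rmult_le_compat_l; [lra|].
    apply Rinv_le_contravar; lra.
  - right. field. lra.
Qed.

(** By [cone_dH] and 2 c <= 1/2, the function H moves by at most
    - ln (1 - u) / 2 along the segment. *)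
Lemma cone_G_bound u : 0 <= u < 1 -> Cmod (G (seg z0 v u)) <= Cmod (G z0) / sqrt (1 - u).
Proof.
  intros Hu.
  assert (Hz0 : Cmod z0 < 1).
  { replace z0 with (seg z0 v 0) by (unfold seg; ring). apply Hin; lra. }
  assert (L := mean_value_seg H dH z0 v (fun t => - (/ 2 * ln (1 - t)))
     (fun t => / 2 / (1 - t)) u (proj1 Hu)).
  assert (D : Cmod (H (seg z0 v u) - H z0) <= - (/ 2 * ln (1 - u)) - - (/ 2 * ln (1 - 0))).
  { apply L.
    - intros t Ht. apply HH, Hin; lra.
    - intros t Ht. auto_derive; [lra|field; lra].
    - intros t Ht. apply derivable_continuous_pt. exists (/ 2 / (1 - t)).
      apply is_derive_Reals. auto_derive; [lra|field; lra].
    - intros t Ht. eapply Rle_trans; [apply cone_dH; lra|].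
      apply Rmult_le_compat_r; [apply Rlt_le, Rinv_0_lt_compat; lra|lra]. }
  rewrite Rminus_0_r, ln_1, Rmult_0_r, Ropp_0, Rminus_0_r in D.
  assert (R0 := Re_le_Cmod (H (seg z0 v u) - H z0)).
  assert (R1 := Rle_abs (Re (H (seg z0 v u) - H z0))).
  change (Re (H (seg z0 v u) - H z0)) with (Re (H (seg z0 v u)) - Re (H z0)) in *.
  rewrite !HGmod by (try apply Hin; lra).
  rewrite <- (Rpower_sqrt (1 - u)) by lra. unfold Rpower, Rdiv.
  rewrite <- exp_Ropp, <- exp_plus. apply exp_le_compat. lra.
Qed.

(** Here |G'| is at most |G z0| * 2 c (1 - u)^(-3/2). *)
Lemma cone_G_var u : 0 <= u < 1 ->
  Cmod (G (seg z0 v u) - G z0) <= 4 * c * Cmod (G z0) * (/ sqrt (1 - u) - 1).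
Proof.
  intros Hu. set (g := Cmod (G z0)). assert (Hg : 0 <= g) by apply Cmod_ge_0.
  assert (L := mean_value_seg G (fun z => G z * dH z)%C z0 v
     (fun t => 4 * c * g * / sqrt (1 - t))
     (fun t => g / sqrt (1 - t) * (2 * c / (1 - t))) u (proj1 Hu)).
  assert (Hd : forall t, 0 <= t <= u ->
    is_derive (fun t => 4 * c * g * / sqrt (1 - t)) t (g / sqrt (1 - t) * (2 * c / (1 - t)))).
  { intros t Ht. assert (Hq : 0 < sqrt (1 - t)) by (apply sqrt_lt_R0; lra).
    auto_derive; [split; [lra|split; [apply Rgt_not_eq, Hq|exact I]]|].
    assert (Q : sqrt (1 - t) * sqrt (1 - t) = 1 - t) by (apply sqrt_sqrt; lra).
    replace (1 + - t) with (1 - t) by ring.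
    rewrite Q. field. lra. }
  eapply Rle_trans; [apply L|].
  - intros t Ht. apply HG, Hin; lra.
  - intros t Ht. apply Hd; lra.
  - intros t Ht. apply derivable_continuous_pt. eexists.
    apply is_derive_Reals. apply Hd; lra.
  - intros t Ht. rewrite <- Cmult_assoc, Cmod_mult.
    apply Rmult_le_compat; try apply Cmod_ge_0; [apply cone_G_bound; lra|apply cone_dH; lra].
  - rewrite Rminus_0_r, sqrt_1. right. field.
    apply Rgt_not_eq, sqrt_lt_R0; lra.
Qed.

(** The derivative of f - G(z0) k is k' (G - G(z0)), so [cone_G_var] applies; the
    function 1 / sqrt (1 - u) - 1 has integral 1 over [0, 1]. *)
Lemma cone_f_var :
  Cmod ((f (z0 + v) - G z0 * k (z0 + v)) - (f z0 - G z0 * k z0)) <= 4 * c * M * s * Cmod (G z0).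
Proof.
  set (g := Cmod (G z0)). assert (Hg : 0 <= g) by apply Cmod_ge_0.
  assert (Hz0 : Cmod z0 < 1).
  { replace z0 with (seg z0 v 0) by (unfold seg; ring). apply Hin; lra. }
  assert (HM0 : 0 <= M) by (eapply Rle_trans; [apply Cmod_ge_0|apply (HM z0 Hz0)]).
  set (A := 4 * c * M * s * g).
  assert (L := mean_value_seg (fun z => f z - G z0 * k z)%C
     (fun z => dk z * G z - G z0 * dk z)%C z0 v
     (fun t => A * (- (2 * sqrt (1 - t)) - t))
     (fun t => A * (/ sqrt (1 - t) - 1)) 1 Rle_0_1).
  replace (z0 + v)%C with (seg z0 v 1) by (unfold seg; ring).
  eapply Rle_trans; [apply L|].
  - intros t Ht. apply has_cderiv_minus; [apply Hf, Hin, Ht|].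
    apply has_cderiv_scal_const, Hk, Hin, Ht.
  - intros t Ht. assert (Hq : 0 < sqrt (1 - t)) by (apply sqrt_lt_R0; lra).
    auto_derive; [lra|]. replace (1 + - t) with (1 - t) by ring. field. lra.
  - intros t Ht. apply continuity_pt_scal. apply continuity_pt_minus.
    + apply continuity_pt_opp, continuity_pt_scal.
      apply (continuity_pt_comp (fun t => 1 - t) sqrt).
      * apply derivable_continuous_pt. exists (-1). apply is_derive_Reals.
        auto_derive; [trivial|ring].
      * apply continuity_pt_sqrt. lra.
    + apply derivable_continuous_pt, derivable_pt_id.
  - intros t Ht.
    replace ((dk (seg z0 v t) * G (seg z0 v t) - G z0 * dk (seg z0 v t)) * v)%C
      with (dk (seg z0 v t) * (G (seg z0 v t) - G z0) * v)%C by ring.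
    rewrite !Cmod_mult.
    assert (E := cone_G_var t ltac:(lra)). fold g in E.
    assert (E1 := HM _ (Hin t ltac:(lra))).
    unfold A. replace (4 * c * M * s * g * (/ sqrt (1 - t) - 1))
      with (M * (4 * c * g * (/ sqrt (1 - t) - 1)) * s) by ring.
    apply Rmult_le_compat; try apply Cmod_ge_0; [|apply Rmult_le_compat|]; try assumption;
      try apply Cmod_ge_0.
    apply Rmult_le_pos; apply Cmod_ge_0.
  - replace (1 - 1) with 0 by ring. rewrite !Rminus_0_r, sqrt_0, sqrt_1. unfold A. right. ring.
Qed.
End Cone.

(** Seen from the apex p of z and w, both f(z) and f(w) agree with G(p) k up to
    4 c M |z - w| |G(p)| and a common constant; the two errors together cannot
    compensate G(p) (k(z) - k(w)). *)
Lemma perturbation_injective (Hlt : 8 * c * M < m) (z w : C) :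
  Cmod z < 1 -> Cmod w < 1 -> f z = f w -> z = w.
Proof.
  intros Hz Hw E.
  destruct (Req_dec (Cmod (z - w)) 0) as [Z|NZ].
  { apply Cmod_eq_0 in Z. replace z with ((z - w) + w)%C by ring. rewrite Z. ring. }
  assert (Hs : 0 < Cmod (z - w)) by (pose proof (Cmod_ge_0 (z - w)); lra).
  exfalso. assert (Esym : Cmod (w - z) = Cmod (z - w)).
  { replace (w - z)%C with (- (z - w))%C by ring. apply Cmod_opp. }
  assert (Hs' : 0 < Cmod (w - z)) by lra.
  assert (Vz := cone_f_var (apex z w) (z - apex z w)%C (Cmod (z - w)) Hs (apex_dist z w Hz Hw Hs)
     (apex_in_disk z w Hz Hw Hs) (apex_height z w Hz Hw)).
  assert (Vw := cone_f_var (apex w z) (w - apex w z)%C (Cmod (w - z)) Hs' (apex_dist w z Hw Hz Hs')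
     (apex_in_disk w z Hw Hz Hs') (apex_height w z Hw Hz)).
  rewrite (apex_sym w z), Esym in Vw. set (p := apex z w) in *. set (s := Cmod (z - w)) in *.
  replace (p + (z - p))%C with z in Vz by ring. replace (p + (w - p))%C with w in Vw by ring.
  assert (Hp : Cmod p < 1).
  { replace p with (seg p (z - p) 0) by (unfold seg; ring). apply apex_in_disk; auto; lra. }
  assert (Hg : 0 < Cmod (G p)) by (rewrite HGmod by exact Hp; apply exp_pos).
  assert (T : Cmod (G p) * Cmod (k z - k w) <= 4 * c * M * s * Cmod (G p) + 4 * c * M * s * Cmod (G p)).
  { rewrite <- Cmod_mult.
    replace (G p * (k z - k w))%C with
      (- ((f z - G p * k z) - (f p - G p * k p)) + ((f w - G p * k w) - (f p - G p * k p)))%C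
      by (rewrite E; ring).
    eapply Rle_trans; [apply Cmod_triangle|]. rewrite Cmod_opp. lra. }
  assert (Q := Hm z w Hz Hw). fold s in Q.
  assert (Cmod (k z - k w) <= 8 * c * M * s).
  { apply Rmult_le_reg_l with (Cmod (G p)); [exact Hg|]. lra. }
  nra.
Qed.
End Perturbation.

(** * Dilations of the Koebe function *)

Definition geo (r : R) (n : nat) : R := r ^ n.
(** The coefficients (n + 1) r^n of 1 / (1 - r z)^2. *)
Definition geo2 (r : R) : nat -> R := PS_derive (PS_incr_1 (geo r)).
Definition koebe_coef (r : R) : nat -> R := PS_incr_1 (geo2 r).
Definition koebe (r : R) : C -> C := cps (koebe_coef r).
Definition koebe_deriv (r : R) : C -> C := cps (PS_derive (koebe_coef r)).

Section Koebe.
Variable r : R.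
Hypothesis Hr : 0 <= r < 1.

Lemma geo_summable : disk_summable (geo r).
Proof.
  apply disk_summable_bounded with 1. intros n. unfold geo.
  rewrite <- RPow_abs, Rabs_pos_eq by lra. rewrite <- (pow1 n). apply pow_incr; lra.
Qed.

Lemma geo2_summable : disk_summable (geo2 r).
Proof. apply disk_summable_derive, disk_summable_incr, geo_summable. Qed.

Lemma koebe_coef_summable : disk_summable (koebe_coef r).
Proof. apply disk_summable_incr, geo2_summable. Qed.

Lemma koebe_deriv_summable : disk_summable (PS_derive (koebe_coef r)).
Proof. apply disk_summable_derive, koebe_coef_summable. Qed.

Section At.
Variable z : C.
Hypothesis Hz : Cmod z < 1.

Lemma geo_eq : (cps (geo r) z * (1 - RtoC r * z))%C = 1.
Proof.
  assert (E := cps_decr _ z geo_summable Hz).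
  rewrite (cps_ext (PS_decr_1 (geo r)) (fun n => r * geo r n)) in E by reflexivity.
  rewrite cps_scal in E. change (geo r 0) with 1 in E.
  replace (cps (geo r) z * (1 - RtoC r * z))%C
    with (cps (geo r) z - z * (RtoC r * cps (geo r) z))%C by ring.
  rewrite E at 1. ring.
Qed.

Lemma geo2_eq : (cps (geo2 r) z * (1 - RtoC r * z))%C = cps (geo r) z.
Proof.
  assert (E := cps_decr _ z geo2_summable Hz).
  rewrite (cps_ext (PS_decr_1 (geo2 r)) (fun n => r * (geo2 r n + geo r n))) in E.
  2:{ intros n. unfold PS_decr_1, geo2, PS_derive, PS_incr_1, geo.
      rewrite (S_INR (S n)). simpl. ring. }
  rewrite cps_scal, cps_plus in E; [|apply geo2_summable|apply geo_summable|exact Hz].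
  change (geo2 r 0) with (INR 1 * 1) in E. simpl INR in E. rewrite Rmult_1_r in E.
  assert (Eg := geo_eq).
  set (W := cps (geo2 r) z) in *. set (g := cps (geo r) z) in *.
  replace (W * (1 - RtoC r * z))%C with (W - z * (RtoC r * W))%C by ring.
  rewrite E at 1. rewrite <- Eg. ring.
Qed.

(** The closed form k'(z) = (1 + r z) / (1 - r z)^3.  The coefficients (n + 1)^2 r^n
    are reduced to those of 1 / (1 - r z)^2 by (n + 2)^2 = (n + 1)^2 + 2 (n + 1) + 1. *)
Lemma koebe_deriv_eq : (koebe_deriv r z * (1 - RtoC r * z) * (1 - RtoC r * z) * (1 - RtoC r * z))%C
  = (1 + RtoC r * z)%C.
Proof.
  assert (E := cps_decr _ z koebe_deriv_summable Hz).
  rewrite (cps_ext (PS_decr_1 (PS_derive (koebe_coef r)))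
     (fun n => r * (PS_derive (koebe_coef r) n + ((geo2 r n + geo2 r n) + geo r n)))) in E.
  2:{ intros n. unfold koebe_coef, PS_decr_1, geo2, PS_derive, PS_incr_1, geo.
      rewrite (S_INR (S n)). simpl (r ^ S n). ring. }
  assert (HW := geo2_summable). assert (Hg := geo_summable).
  rewrite cps_scal, !cps_plus in E; auto using disk_summable_plus, koebe_deriv_summable.
  change (PS_derive (koebe_coef r) 0) with (INR 1 * (INR 1 * 1)) in E.
  simpl INR in E. rewrite !Rmult_1_r in E.
  assert (Eg := geo_eq). assert (Ew := geo2_eq). unfold koebe_deriv.
  set (X := cps (PS_derive (koebe_coef r)) z) in *.
  set (W := cps (geo2 r) z) in *. set (g := cps (geo r) z) in *.
  assert (E2 : (X * (1 - RtoC r * z) = 1 + RtoC r * z * (W + W + g))%C).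
  { replace (X * (1 - RtoC r * z))%C with (X - z * (RtoC r * X))%C by ring.
    rewrite E at 1. ring. }
  rewrite E2.
  replace ((1 + RtoC r * z * (W + W + g)) * (1 - RtoC r * z) * (1 - RtoC r * z))%C
    with ((1 - RtoC r * z) * (1 - RtoC r * z) + RtoC r * z *
      (2 * ((W * (1 - RtoC r * z)) * (1 - RtoC r * z))
       + (g * (1 - RtoC r * z)) * (1 - RtoC r * z)))%C by ring.
  rewrite Ew, Eg. ring.
Qed.

Lemma koebe_eq : (koebe r z * ((1 - RtoC r * z) * (1 - RtoC r * z)))%C = z.
Proof.
  unfold koebe, koebe_coef. rewrite cps_incr by (auto; apply geo2_summable).
  replace (z * cps (geo2 r) z * ((1 - RtoC r * z) * (1 - RtoC r * z)))%C
    with (z * ((cps (geo2 r) z * (1 - RtoC r * z)) * (1 - RtoC r * z)))%C by ring.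
  rewrite geo2_eq, geo_eq. ring.
Qed.

Lemma one_minus_bounds (t : R) (x : C) : 0 <= t < 1 -> Cmod x < 1 ->
  1 - t <= Cmod (1 - RtoC t * x) <= 2.
Proof.
  intros Ht Hx. assert (H0 := Cmod_ge_0 x).
  assert (E : Cmod (RtoC t * x) = t * Cmod x).
  { rewrite Cmod_mult, Cmod_R, Rabs_pos_eq; lra. }
  split.
  - assert (K := Cmod_triangle (1 - RtoC t * x) (RtoC t * x)).
    replace (1 - RtoC t * x + RtoC t * x)%C with (RtoC 1) in K by ring.
    rewrite Cmod_1, E in K. nra.
  - unfold Cminus. eapply Rle_trans; [apply Cmod_triangle|].
    rewrite Cmod_opp, Cmod_1, E. nra.
Qed.

Lemma one_plus_bounds : 1 - r <= Cmod (1 + RtoC r * z) <= 2.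
Proof.
  replace (1 + RtoC r * z)%C with (1 - RtoC r * (- z))%C by ring.
  apply one_minus_bounds; [exact Hr|rewrite Cmod_opp; exact Hz].
Qed.

Lemma koebe_deriv_upper : Cmod (koebe_deriv r z) <= 2 / ((1 - r) * (1 - r) * (1 - r)).
Proof.
  assert (E := f_equal Cmod koebe_deriv_eq). rewrite !Cmod_mult in E.
  assert (B := one_plus_bounds). assert (D := one_minus_bounds r z Hr Hz).
  set (d := Cmod (1 - RtoC r * z)) in *. set (x := Cmod (koebe_deriv r z)) in *.
  assert (Hx : 0 <= x) by apply Cmod_ge_0.
  assert (P : 0 < (1 - r) * (1 - r)) by nra.
  assert (P3 : 0 < (1 - r) * (1 - r) * (1 - r)) by nra.
  apply Rmult_le_reg_r with ((1 - r) * (1 - r) * (1 - r)); [exact P3|].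
  replace (2 / ((1 - r) * (1 - r) * (1 - r)) * ((1 - r) * (1 - r) * (1 - r))) with 2
    by (field; lra).
  apply Rle_trans with (x * d * d * d); [|lra].
  assert ((1 - r) * (1 - r) <= d * d) by nra.
  assert ((1 - r) * (1 - r) * (1 - r) <= d * d * d) by nra. nra.
Qed.

Lemma koebe_deriv_lower : (1 - r) / 8 <= Cmod (koebe_deriv r z).
Proof.
  assert (E := f_equal Cmod koebe_deriv_eq). rewrite !Cmod_mult in E.
  assert (B := one_plus_bounds). assert (D := one_minus_bounds r z Hr Hz).
  set (d := Cmod (1 - RtoC r * z)) in *. set (x := Cmod (koebe_deriv r z)) in *.
  assert (Hx : 0 <= x) by apply Cmod_ge_0.
  assert (d * d <= 4) by nra. assert (d * d * d <= 8) by nra. nra.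
Qed.
End At.

(** From (k(z) - k(w)) (1 - r z)^2 (1 - r w)^2 = (z - w) (1 - r^2 z w). *)
Lemma koebe_lower z w : Cmod z < 1 -> Cmod w < 1 ->
  (1 - r) / 16 * Cmod (z - w) <= Cmod (koebe r z - koebe r w).
Proof.
  intros Hz Hw.
  assert (Ez := koebe_eq z Hz). assert (Ew := koebe_eq w Hw).
  set (p := (1 - RtoC r * z)%C) in *. set (q := (1 - RtoC r * w)%C) in *.
  assert (E : ((koebe r z - koebe r w) * ((p * p) * (q * q)) =
     (z - w) * (1 - RtoC (r * r) * (z * w)))%C).
  { replace ((koebe r z - koebe r w) * ((p * p) * (q * q)))%C with
      (koebe r z * (p * p) * (q * q) - koebe r w * (q * q) * (p * p))%C by ring.
    rewrite Ez, Ew, RtoC_mult. unfold p, q. ring. }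
  apply (f_equal Cmod) in E. rewrite !Cmod_mult in E.
  assert (Bp := one_minus_bounds r z Hr Hz). assert (Bq := one_minus_bounds r w Hr Hw).
  assert (Hzw : Cmod (z * w) < 1).
  { rewrite Cmod_mult. pose proof (Cmod_ge_0 z). pose proof (Cmod_ge_0 w). nra. }
  assert (Brr := one_minus_bounds (r * r) (z * w) ltac:(nra) Hzw).
  fold p in Bp. fold q in Bq.
  set (s := Cmod (z - w)) in *. assert (0 <= s) by apply Cmod_ge_0.
  set (x := Cmod (koebe r z - koebe r w)) in *. assert (0 <= x) by apply Cmod_ge_0.
  assert (Cmod p * Cmod p <= 4) by nra. assert (Cmod q * Cmod q <= 4) by nra.
  assert (0 <= Cmod p * Cmod p) by nra. assert (0 <= Cmod q * Cmod q) by nra.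
  assert ((Cmod p * Cmod p) * (Cmod q * Cmod q) <= 16) by nra.
  assert (1 - r <= Cmod (1 - RtoC (r * r) * (z * w))) by nra.
  nra.
Qed.
End Koebe.

(** * Moments of the lacunary series on circles *)

Definition cont (f : R -> R) : Prop := forall x, continuous f x.

Lemma cont_of_pt f : (forall x, continuity_pt f x) -> cont f.
Proof. intros H x. apply continuity_pt_filterlim, H. Qed.

Lemma cont_plus f g : cont f -> cont g -> cont (fun t => f t + g t).
Proof. intros Hf Hg x. apply (continuous_plus (V := R_NormedModule) f g x (Hf x) (Hg x)). Qed.

Lemma cont_mult f g : cont f -> cont g -> cont (fun t => f t * g t).
Proof. intros Hf Hg x. apply (continuous_mult (K := R_AbsRing) f g x (Hf x) (Hg x)). Qed.

Lemma cont_const c : cont (fun _ => c).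
Proof. intros x. apply continuous_const. Qed.

Lemma cont_cos : cont cos.
Proof. apply cont_of_pt. intros x. apply continuity_cos. Qed.

Lemma cont_affine f a b : cont f -> cont (fun t => f (a * t + b)).
Proof.
  intros Hf x. apply (continuous_comp (fun t => a * t + b) f); [|apply Hf].
  apply cont_plus; [apply cont_mult; [apply cont_const|intros y; apply continuous_id]|apply cont_const].
Qed.

Lemma cont_ext f g : (forall t, f t = g t) -> cont f -> cont g.
Proof. intros E Hf x. apply (continuous_ext f g x E (Hf x)). Qed.

Lemma cont_pow f n : cont f -> cont (fun t => f t ^ n).
Proof.
  intros Hf. induction n as [|n IH]; simpl; [apply cont_const|apply cont_mult; assumption].
Qed.

Lemma cont_ex_RInt f a b : cont f -> ex_RInt f a b.
Proof. intros Hf. apply (ex_RInt_continuous (V := R_CompleteNormedModule)). intros; apply Hf. Qed.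

Definition circle_int (f : R -> R) : R := RInt f 0 (2 * PI).

Lemma two_PI_pos : 0 < 2 * PI.
Proof. pose proof PI_RGT_0. lra. Qed.

Lemma circle_int_ext f g : (forall t, f t = g t) -> circle_int f = circle_int g.
Proof. intros E. apply RInt_ext. intros; apply E. Qed.

Lemma circle_int_plus f g : cont f -> cont g -> circle_int (fun t => f t + g t) = circle_int f + circle_int g.
Proof.
  intros Hf Hg. apply (RInt_plus (V := R_CompleteNormedModule)); apply cont_ex_RInt; assumption.
Qed.

Lemma circle_int_scal c f : cont f -> circle_int (fun t => c * f t) = c * circle_int f.
Proof.
  intros Hf. apply (RInt_scal (V := R_CompleteNormedModule)). apply cont_ex_RInt; assumption.
Qed.

Lemma circle_int_const c : circle_int (fun _ => c) = 2 * PI * c.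
Proof.
  unfold circle_int. rewrite (RInt_const (V := R_CompleteNormedModule)).
  change (scal ?p ?q) with (p * q). ring.
Qed.

Lemma circle_int_le f g : cont f -> cont g -> (forall t, f t <= g t) -> circle_int f <= circle_int g.
Proof.
  intros Hf Hg H. pose proof two_PI_pos.
  apply RInt_le; [lra|apply cont_ex_RInt, Hf|apply cont_ex_RInt, Hg|intros; apply H].
Qed.

Lemma RInt_translate f a b s : cont f ->
  RInt (fun t => f (t + s)) a b = RInt f (a + s) (b + s).
Proof.
  intros Hf.
  assert (E := RInt_comp_lin (V := R_CompleteNormedModule) f 1 s a b (cont_ex_RInt f _ _ Hf)).
  rewrite !Rmult_1_l in E. rewrite <- E. apply RInt_ext. intros x _.
  change (scal ?p ?q) with (p * q). rewrite !Rmult_1_l. reflexivity.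
Qed.

Lemma RInt_cat f a b c : cont f -> RInt f a b + RInt f b c = RInt f a c.
Proof.
  intros Hf. apply (RInt_Chasles (V := R_CompleteNormedModule)); apply cont_ex_RInt, Hf.
Qed.

Section Periodic.
Variable f : R -> R.
Hypothesis (Hf : cont f) (Hper : forall t, f (t + 2 * PI) = f t).

Lemma RInt_period s : RInt f s (s + 2 * PI) = circle_int f.
Proof.
  unfold circle_int.
  assert (E1 := RInt_cat f 0 s (s + 2 * PI) Hf).
  assert (E2 := RInt_cat f 0 (2 * PI) (s + 2 * PI) Hf).
  assert (E3 := RInt_translate f 0 s (2 * PI) Hf). rewrite Rplus_0_l in E3.
  rewrite <- E3 in E2.
  rewrite (RInt_ext (fun t => f (t + 2 * PI)) f) in E2 by (intros; apply Hper).
  change (RInt f 0 s) with (RInt (V := R_CompleteNormedModule) f 0 s) in *. lra.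
Qed.

Lemma circle_int_shift s : circle_int (fun t => f (t + s)) = circle_int f.
Proof.
  unfold circle_int at 1. rewrite RInt_translate by exact Hf.
  rewrite Rplus_0_l, Rplus_comm. apply RInt_period.
Qed.

Lemma circle_int_dilate4 : circle_int (fun t => f (4 * t)) = circle_int f.
Proof.
  assert (E := RInt_comp_lin (V := R_CompleteNormedModule) f 4 0 0 (2 * PI) (cont_ex_RInt f _ _ Hf)).
  replace (4 * 0 + 0) with 0 in E by ring. replace (4 * (2 * PI) + 0) with (8 * PI) in E by ring.
  assert (C4 : RInt f 0 (8 * PI) = 4 * circle_int f).
  { assert (P1 := RInt_period 0). assert (P2 := RInt_period (2 * PI)).
    assert (P3 := RInt_period (4 * PI)). assert (P4 := RInt_period (6 * PI)).
    replace (0 + 2 * PI) with (2 * PI) in P1 by ring.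
    replace (2 * PI + 2 * PI) with (4 * PI) in P2 by ring.
    replace (4 * PI + 2 * PI) with (6 * PI) in P3 by ring.
    replace (6 * PI + 2 * PI) with (8 * PI) in P4 by ring.
    rewrite <- (RInt_cat f 0 (6 * PI) (8 * PI)), <- (RInt_cat f 0 (4 * PI) (6 * PI)),
      <- (RInt_cat f 0 (2 * PI) (4 * PI)) by exact Hf. lra. }
  rewrite C4 in E.
  assert (Hc : cont (fun t => f (4 * t))).
  { apply (cont_ext (fun t => f (4 * t + 0))); [intros; rewrite Rplus_0_r; reflexivity|].
    apply cont_affine, Hf. }
  rewrite (RInt_ext _ (fun t => 4 * f (4 * t))) in E.
  2:{ intros x _. change (scal ?p ?q) with (p * q). rewrite Rplus_0_r. reflexivity. }
  change (circle_int (fun t => 4 * f (4 * t)) = 4 * circle_int f) in E.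
  rewrite circle_int_scal in E by exact Hc. lra.
Qed.
End Periodic.

Section Quarter.
Variable g : R -> R.
Hypothesis (Hg : cont g) (Hq : forall t, g (t + PI / 2) = g t).

Lemma quarter_half t : g (t + PI) = g t.
Proof. replace (t + PI) with (t + PI / 2 + PI / 2) by field. rewrite !Hq. reflexivity. Qed.

Lemma quarter_full t : g (t + 2 * PI) = g t.
Proof. replace (t + 2 * PI) with (t + PI + PI) by ring. rewrite !quarter_half. reflexivity. Qed.

(** A half turn leaves g unchanged and changes the sign of phi. *)
Lemma circle_int_odd_quarter phi : cont phi -> (forall t, phi (t + PI) = - phi t) ->
  circle_int (fun t => phi t * g t) = 0.
Proof.
  intros Hphi Hodd.
  assert (Hc : cont (fun t => phi t * g t)) by (apply cont_mult; assumption).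
  assert (E := circle_int_shift (fun t => phi t * g t) Hc).
  rewrite <- E with (s := PI) at 1.
  2:{ intros t. rewrite quarter_full. replace (t + 2 * PI) with (t + PI + PI) by ring.
      rewrite !Hodd. ring. }
  assert (E2 : circle_int (fun t => phi (t + PI) * g (t + PI)) = - 1 * circle_int (fun t => phi t * g t)).
  { rewrite <- circle_int_scal by exact Hc. apply circle_int_ext. intros t.
    rewrite Hodd, quarter_half. ring. }
  assert (E3 : circle_int (fun t => phi (t + PI) * g (t + PI)) = circle_int (fun t => phi t * g t)).
  { apply E. intros t. rewrite quarter_full. replace (t + 2 * PI) with (t + PI + PI) by ring.
    rewrite !Hodd. ring. }
  lra.
Qed.

(** A quarter turn leaves g unchanged and exchanges the squares of cos and sin,
    which sum to 1. *)
Lemma circle_int_cos2_quarter : circle_int (fun t => cos t ^ 2 * g t) = circle_int g / 2.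
Proof.
  assert (Hc : cont (fun t => cos t ^ 2 * g t)).
  { apply cont_mult; [apply cont_pow, cont_cos|exact Hg]. }
  assert (E : circle_int (fun t => cos (t + PI / 2) ^ 2 * g (t + PI / 2)) = circle_int (fun t => cos t ^ 2 * g t)).
  { apply (circle_int_shift (fun t => cos t ^ 2 * g t) Hc). intros t.
    rewrite quarter_full, cos_plus, cos_2PI, sin_2PI. ring. }
  assert (E2 : circle_int (fun t => cos (t + PI / 2) ^ 2 * g (t + PI / 2))
               = circle_int g + - 1 * circle_int (fun t => cos t ^ 2 * g t)).
  { rewrite <- circle_int_scal by exact Hc. rewrite <- circle_int_plus; [|exact Hg|].
    - apply circle_int_ext. intros t. rewrite Hq, cos_plus, cos_PI2, sin_PI2.
      assert (T := sin2_cos2 t). unfold Rsqr in T.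
      replace ((cos t * 0 - sin t * 1) ^ 2) with (sin t * sin t) by ring.
      replace (sin t * sin t) with (1 - cos t * cos t) by lra. ring.
    - apply cont_mult; [apply cont_const|exact Hc]. }
  lra.
Qed.
End Quarter.

Lemma Cmod_circle r t : 0 <= r -> Cmod (circle_point r t) = r.
Proof.
  intros Hr. unfold circle_point, Cmod; simpl.
  replace (r * cos t * (r * cos t * 1) + r * sin t * (r * sin t * 1)) with (r * r).
  - apply sqrt_square, Hr.
  - assert (T := sin2_cos2 t). unfold Rsqr in T.
    replace (r * cos t * (r * cos t * 1) + r * sin t * (r * sin t * 1))
      with (r * r * (sin t * sin t + cos t * cos t)) by ring. rewrite T. ring.
Qed.

Lemma circle_mult r s t u :
  (circle_point r t * circle_point s u)%C = circle_point (r * s) (t + u).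
Proof.
  unfold circle_point, Cmult; simpl. rewrite cos_plus, sin_plus. f_equal; ring.
Qed.

Lemma circle_pow4 r t : (circle_point r t ^ 4)%C = circle_point (r ^ 4) (4 * t).
Proof.
  replace (circle_point r t ^ 4)%C with
    (circle_point r t * circle_point r t * (circle_point r t * circle_point r t))%C
    by (simpl; ring).
  rewrite !circle_mult. f_equal; ring.
Qed.

Lemma circle_continuous r t e : 0 < e ->
  exists d, 0 < d /\ forall u, Rabs (u - t) < d -> Cmod (circle_point r u - circle_point r t) < e.
Proof.
  intros He.
  assert (HR := Rabs_pos r).
  assert (He' : 0 < e / (2 * (1 + Rabs r))) by (apply Rdiv_lt_0_compat; lra).
  assert (K : forall f, continuity f -> exists d, 0 < d /\
     forall u, Rabs (u - t) < d -> Rabs (f u - f t) < e / (2 * (1 + Rabs r))).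
  { intros f Hf. destruct (Hf t _ He') as [d [Hd H]]. exists d. split; [exact Hd|].
    intros u Hu. destruct (Req_dec t u) as [->|Hne].
    - replace (f u - f u) with 0 by ring. rewrite Rabs_R0. exact He'.
    - apply (H u). repeat split; auto. }
  destruct (K cos continuity_cos) as [d1 [Hd1 H1]].
  destruct (K sin continuity_sin) as [d2 [Hd2 H2]].
  exists (Rmin d1 d2). split; [apply Rmin_pos; assumption|]. intros u Hu.
  specialize (H1 u (Rlt_le_trans _ _ _ Hu (Rmin_l _ _))).
  specialize (H2 u (Rlt_le_trans _ _ _ Hu (Rmin_r _ _))).
  replace (circle_point r u - circle_point r t)%C with
    (RtoC (r * (cos u - cos t)) + Ci * RtoC (r * (sin u - sin t)))%C.
  2:{ unfold circle_point, Cminus, Cplus, Copp, Cmult, Ci, RtoC; simpl. f_equal; ring. }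
  eapply Rle_lt_trans; [apply Cmod_triangle|].
  rewrite Cmod_mult, Cmod_Ci, !Cmod_R, !Rabs_mult, Rmult_1_l.
  apply Rle_lt_trans with ((1 + Rabs r) * (Rabs (cos u - cos t) + Rabs (sin u - sin t))).
  - pose proof (Rabs_pos (cos u - cos t)). pose proof (Rabs_pos (sin u - sin t)). nra.
  - apply Rlt_le_trans with ((1 + Rabs r) * (e / (2 * (1 + Rabs r)) + e / (2 * (1 + Rabs r)))).
    + apply Rmult_lt_compat_l; lra.
    + right. field. lra.
Qed.

(** P stands for the real part or the modulus. *)
Lemma cont_on_circle (F : C -> C) (P : C -> R) (r : R) :
  (forall z, Cmod z < 1 -> exists l, has_cderiv F z l) ->
  (forall a b, Rabs (P a - P b) <= Cmod (a - b)) -> 0 <= r < 1 ->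
  cont (fun t => P (F (circle_point r t))).
Proof.
  intros HF HP Hr. apply cont_of_pt. intros t e He.
  destruct (HF (circle_point r t)) as [l Hl]; [rewrite Cmod_circle; lra|].
  destruct (has_cderiv_continuous _ _ _ Hl e He) as [d [Hd H]].
  destruct (circle_continuous r t d Hd) as [d' [Hd' H']].
  exists d'. split; [exact Hd'|]. intros u [_ Hu]. simpl in *. unfold Rdist in *.
  eapply Rle_lt_trans; [apply HP|]. apply H, H', Hu.
Qed.

Lemma Re_lip a b : Rabs (Re a - Re b) <= Cmod (a - b).
Proof. apply (Re_le_Cmod (a - b)). Qed.

Lemma Cmod_lip a b : Rabs (Cmod a - Cmod b) <= Cmod (a - b).
Proof.
  assert (T1 := Cmod_triangle (a - b) b). assert (T2 := Cmod_triangle (b - a) a).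
  replace (a - b + b)%C with a in T1 by ring. replace (b - a + a)%C with b in T2 by ring.
  replace (b - a)%C with (- (a - b))%C in T2 by ring. rewrite Cmod_opp in T2.
  apply Rabs_le. lra.
Qed.

Definition lac_re (r t : R) : R := Re (cps lac (circle_point r t)).
Definition moment (n : nat) (r : R) : R := circle_int (fun t => lac_re r t ^ n).

Lemma pow4_in r : 0 < r < 1 -> 0 < r ^ 4 < 1.
Proof.
  intros Hr. split; [apply pow_lt; lra|]. assert (r * r < 1) by nra. simpl. nra.
Qed.

Lemma lac_re_cont r : 0 < r < 1 -> cont (lac_re r).
Proof.
  intros Hr. apply (cont_on_circle (cps lac) Re r); [|apply Re_lip|lra].
  intros z Hz. eexists. apply cps_derive; [apply lac_summable|exact Hz].
Qed.

Lemma lac_re_functional r t : 0 < r < 1 -> lac_re r t = r * cos t + lac_re (r ^ 4) (4 * t).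
Proof.
  intros Hr. unfold lac_re. rewrite cps_lac_functional by (rewrite Cmod_circle; lra).
  rewrite circle_pow4. reflexivity.
Qed.

Lemma lac_re_small r t : 0 < r < 1 -> Rabs (lac_re r t) <= r / (1 - r).
Proof.
  intros Hr. eapply Rle_trans; [apply Re_le_Cmod|].
  eapply Rle_trans; [apply cps_lac_small; rewrite Cmod_circle; lra|].
  rewrite Cmod_circle by lra. apply Rle_refl.
Qed.

Lemma lac_re_periodic r t : lac_re r (t + 2 * PI) = lac_re r t.
Proof.
  unfold lac_re, circle_point. rewrite cos_plus, sin_plus, cos_2PI, sin_2PI.
  do 3 f_equal; ring.
Qed.

Section Step.
Variable r : R.
Hypothesis Hr : 0 < r < 1.
Let tail t := lac_re (r ^ 4) (4 * t).

Lemma lac_re_split t : lac_re r t = r * cos t + tail t.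
Proof. apply lac_re_functional, Hr. Qed.

Lemma tail_cont : cont tail.
Proof.
  apply (cont_ext (fun t => lac_re (r ^ 4) (4 * t + 0))); [intros; unfold tail; f_equal; ring|].
  apply cont_affine, lac_re_cont, pow4_in, Hr.
Qed.

Lemma tail_pow_quarter n t : tail (t + PI / 2) ^ n = tail t ^ n.
Proof.
  unfold tail. replace (4 * (t + PI / 2)) with (4 * t + 2 * PI) by field.
  rewrite lac_re_periodic. reflexivity.
Qed.

Lemma tail_mom n : circle_int (fun t => tail t ^ n) = moment n (r ^ 4).
Proof.
  apply (circle_int_dilate4 (fun t => lac_re (r ^ 4) t ^ n)).
  - apply cont_pow, lac_re_cont, pow4_in, Hr.
  - intros t. rewrite lac_re_periodic. reflexivity.
Qed.

Lemma tail_odd n m : circle_int (fun t => cos t ^ S (2 * n) * tail t ^ m) = 0.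
Proof.
  apply (circle_int_odd_quarter (fun t => tail t ^ m)).
  - apply cont_pow, tail_cont.
  - apply tail_pow_quarter.
  - apply cont_pow, cont_cos.
  - intros t. rewrite neg_cos. replace (- cos t) with (-1 * cos t) by ring.
    rewrite Rpow_mult_distr, pow_1_odd. ring.
Qed.

Lemma tail_cos2 m : circle_int (fun t => cos t ^ 2 * tail t ^ m) = moment m (r ^ 4) / 2.
Proof.
  rewrite <- tail_mom. apply circle_int_cos2_quarter; [apply cont_pow, tail_cont|apply tail_pow_quarter].
Qed.

Lemma moment_1_step : moment 1 r = moment 1 (r ^ 4).
Proof.
  assert (Z1 : circle_int (fun t => cos t * 1 * 1) = 0) by apply (tail_odd 0 0).
  assert (M : circle_int (fun t => tail t * 1) = moment 1 (r ^ 4)) by apply (tail_mom 1).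
  unfold moment at 1.
  rewrite (circle_int_ext _ (fun t => r * (cos t * 1 * 1) + tail t * 1)).
  2:{ intros t. rewrite lac_re_split. ring. }
  assert (Hz := tail_cont). assert (Hcos := cont_cos). assert (H1 := cont_const).
  rewrite circle_int_plus, circle_int_scal; auto 6 using cont_mult.
  rewrite Z1, M. ring.
Qed.

Lemma moment_2_step : moment 2 r = PI * r ^ 2 + moment 2 (r ^ 4).
Proof.
  assert (Z1 : circle_int (fun t => cos t * 1 * (tail t * 1)) = 0) by apply (tail_odd 0 1).
  assert (Z2 : circle_int (fun t => cos t * (cos t * 1) * 1) = moment 0 (r ^ 4) / 2) by apply (tail_cos2 0).
  assert (M2 : circle_int (fun t => tail t * (tail t * 1)) = moment 2 (r ^ 4)) by apply (tail_mom 2).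
  assert (M0 : moment 0 (r ^ 4) = 2 * PI) by (unfold moment; simpl; rewrite circle_int_const; ring).
  rewrite M0 in Z2.
  unfold moment at 1.
  rewrite (circle_int_ext _ (fun t => r ^ 2 * (cos t * (cos t * 1) * 1)
     + (2 * r * (cos t * 1 * (tail t * 1)) + tail t * (tail t * 1)))).
  2:{ intros t. rewrite lac_re_split. ring. }
  assert (Hz := tail_cont). assert (Hcos := cont_cos). assert (H1 := cont_const).
  rewrite !circle_int_plus, !circle_int_scal; auto 8 using cont_mult, cont_plus.
  rewrite Z1, Z2, M2. field.
Qed.

(** In the expansion of (r cos t + tail t)^4 the terms odd in the cosine vanish, the
    square of the cosine averages to 1/2, which turns 6 into 3, and the fourth power
    of the cosine is at most 1. *)
Lemma moment_4_step : moment 4 r <= 2 * PI * r ^ 4 + 3 * r ^ 2 * moment 2 (r ^ 4) + moment 4 (r ^ 4).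
Proof.
  assert (Z3 : circle_int (fun t => cos t * (cos t * (cos t * 1)) * (tail t * 1)) = 0)
    by apply (tail_odd 1 1).
  assert (Z1 : circle_int (fun t => cos t * 1 * (tail t * (tail t * (tail t * 1)))) = 0) by apply (tail_odd 0 3).
  assert (Z2 : circle_int (fun t => cos t * (cos t * 1) * (tail t * (tail t * 1))) = moment 2 (r ^ 4) / 2)
    by apply (tail_cos2 2).
  assert (M4 : circle_int (fun t => tail t * (tail t * (tail t * (tail t * 1)))) = moment 4 (r ^ 4)) by apply (tail_mom 4).
  assert (Hz := tail_cont). assert (Hcos := cont_cos). assert (H1 := cont_const).
  unfold moment at 1.
  apply Rle_trans with (circle_int (fun t => r ^ 4 * 1
     + (4 * r ^ 3 * (cos t * (cos t * (cos t * 1)) * (tail t * 1))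
     + (6 * r ^ 2 * (cos t * (cos t * 1) * (tail t * (tail t * 1)))
     + (4 * r * (cos t * 1 * (tail t * (tail t * (tail t * 1))))
     + tail t * (tail t * (tail t * (tail t * 1)))))))).
  - apply circle_int_le; [apply cont_pow, lac_re_cont, Hr|auto 12 using cont_mult, cont_plus|].
    intros t. rewrite lac_re_split.
    assert (C4 : r ^ 4 * (cos t * cos t * (cos t * cos t)) <= r ^ 4 * 1).
    { apply Rmult_le_compat_l; [apply pow_le; lra|].
      pose proof (COS_bound t). assert (0 <= cos t * cos t <= 1) by nra. nra. }
    nra.
  - rewrite !circle_int_plus, !circle_int_scal; auto 12 using cont_mult, cont_plus.
    rewrite Z1, Z2, Z3, M4, circle_int_const. lra.
Qed.
End Step.

(** Iterating gives D r <= D (r^(4^n)), and r^(4^n) tends to 0. *)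
Lemma descent (D : R -> R) (K : R) :
  0 <= K -> (forall r, 0 < r < 1 -> D r <= D (r ^ 4)) ->
  (forall r, 0 < r <= 1 / 2 -> D r <= K * r) ->
  forall r, 0 < r < 1 -> D r <= 0.
Proof.
  intros HK Hstep Hsmall r Hr.
  assert (It : forall n, 0 < r ^ (4 ^ n) < 1 /\ D r <= D (r ^ (4 ^ n))).
  { induction n as [|n [I1 I2]]; [simpl; rewrite Rmult_1_r; split; lra|].
    rewrite Nat.pow_succ_r', Nat.mul_comm, pow_mult. split; [apply pow4_in, I1|].
    eapply Rle_trans; [exact I2|apply Hstep, I1]. }
  apply Rnot_lt_le. intros Hpos.
  set (e := Rmin (1 / 2) (D r / (1 + K))).
  assert (Hq : 0 < D r / (1 + K)) by (apply Rdiv_lt_0_compat; lra).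
  assert (He : 0 < e) by (apply Rmin_pos; lra).
  destruct (pow_lt_1_zero r ltac:(rewrite Rabs_pos_eq; lra) e He) as [N HN].
  assert (Hge : (4 ^ N >= N)%nat) by (assert (N < 4 ^ N)%nat by (apply Nat.pow_gt_lin_r; lia); lia).
  specialize (HN _ Hge). destruct (It N) as [I1 I2].
  rewrite Rabs_pos_eq in HN by lra.
  assert (r ^ (4 ^ N) < 1 / 2) by (eapply Rlt_le_trans; [exact HN|apply Rmin_l]).
  assert (r ^ (4 ^ N) < D r / (1 + K)) by (eapply Rlt_le_trans; [exact HN|apply Rmin_r]).
  assert (T := Hsmall (r ^ (4 ^ N)) ltac:(lra)).
  assert ((1 + K) * (r ^ (4 ^ N)) < D r).
  { apply Rlt_le_trans with ((1 + K) * (D r / (1 + K))); [|right; field; lra].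
    apply Rmult_lt_compat_l; lra. }
  lra.
Qed.

Lemma lac_re_half r t : 0 < r <= 1 / 2 -> Rabs (lac_re r t) <= 2 * r.
Proof.
  intros Hr. eapply Rle_trans; [apply lac_re_small; lra|].
  apply Rmult_le_reg_r with (1 - r); [lra|].
  unfold Rdiv. rewrite Rmult_assoc, Rinv_l by lra. nra.
Qed.

Lemma moment_1_zero r : 0 < r < 1 -> moment 1 r = 0.
Proof.
  intros Hr. assert (HP := PI_RGT_0).
  assert (B : forall s, 0 < s <= 1 / 2 -> Rabs (moment 1 s) <= 4 * PI * s).
  { intros s Hs. assert (Hc : cont (fun t => lac_re s t ^ 1)) by (apply cont_pow, lac_re_cont; lra).
    replace (4 * PI * s) with (2 * PI * (2 * s)) by ring.
    apply Rabs_le. split.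
    - rewrite Ropp_mult_distr_r, <- circle_int_const. apply circle_int_le; [apply cont_const|exact Hc|].
      intros t. pose proof (lac_re_half s t Hs) as T. apply Rabs_le_between in T. simpl; lra.
    - rewrite <- circle_int_const. apply circle_int_le; [exact Hc|apply cont_const|].
      intros t. pose proof (lac_re_half s t Hs) as T. apply Rabs_le_between in T. simpl; lra. }
  apply Rle_antisym.
  - apply (descent (moment 1) (4 * PI)); [lra| |  |exact Hr].
    + intros s Hs. rewrite (moment_1_step s Hs). apply Rle_refl.
    + intros s Hs. eapply Rle_trans; [apply Rle_abs|apply B, Hs].
  - apply Ropp_le_cancel. rewrite Ropp_0.
    apply (descent (fun s => - moment 1 s) (4 * PI)); [lra| |  |exact Hr].
    + intros s Hs. rewrite (moment_1_step s Hs). apply Rle_refl.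
    + intros s Hs. eapply Rle_trans; [apply Rle_abs|]. rewrite Rabs_Ropp. apply B, Hs.
Qed.

Lemma moment_2_pos r : 0 < r < 1 -> 0 <= moment 2 r.
Proof.
  intros Hr. rewrite <- (Rmult_0_r (2 * PI)), <- circle_int_const.
  apply circle_int_le; [apply cont_const|apply cont_pow, lac_re_cont, Hr|].
  intros t. simpl. nra.
Qed.

(** The defect pi m_4 - 2 m_2^2 does not decrease when rho is replaced by rho^4: by the
    recurrences, the expansion of 2 (pi rho^2 + m_2)^2 dominates the increment of
    pi m_4 term by term.  The defect is small for small rho. *)
Lemma moment_4_bound r : 0 < r < 1 -> PI * moment 4 r <= 2 * (moment 2 r * moment 2 r).
Proof.
  intros Hr. assert (HP := PI_RGT_0).
  assert (K : PI * moment 4 r - 2 * (moment 2 r * moment 2 r) <= 0); [|lra].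
  apply (descent (fun r => PI * moment 4 r - 2 * (moment 2 r * moment 2 r)) (4 * PI * PI));
    [nra| | |exact Hr].
  - intros s Hs. assert (S4 := moment_4_step s Hs). rewrite (moment_2_step s Hs).
    assert (P2 := moment_2_pos (s ^ 4) (pow4_in s Hs)).
    set (a := moment 2 (s ^ 4)) in *. set (b := moment 4 (s ^ 4)) in *.
    assert (PI * moment 4 s <= PI * (2 * PI * s ^ 4 + 3 * s ^ 2 * a + b))
      by (apply Rmult_le_compat_l; lra).
    assert (0 <= PI * (s ^ 2 * a)).
    { apply Rmult_le_pos; [lra|apply Rmult_le_pos; [apply pow_le; lra|exact P2]]. }
    nra.
  - intros s Hs. assert (P2 := moment_2_pos s ltac:(lra)).
    assert (B : moment 4 s <= 2 * PI * (2 * s)).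
    { rewrite <- circle_int_const. apply circle_int_le; [apply cont_pow, lac_re_cont; lra|apply cont_const|].
      intros t. pose proof (lac_re_half s t Hs) as T.
      replace (lac_re s t ^ 4) with (Rabs (lac_re s t) ^ 4).
      2:{ rewrite RPow_abs. apply Rabs_pos_eq. replace (lac_re s t ^ 4) with (Rsqr (lac_re s t * lac_re s t))
            by (unfold Rsqr; ring). apply Rle_0_sqr. }
      assert (A0 := Rabs_pos (lac_re s t)). set (y := Rabs (lac_re s t)) in *.
      assert (y <= 1) by lra. assert (y * y <= 1) by nra. assert (y * y * y <= 1) by nra.
      simpl. nra. }
    assert (PI * moment 4 s <= PI * (2 * PI * (2 * s))) by (apply Rmult_le_compat_l; lra).
    nra.
Qed.

(** Passing from r to its fourth root adds pi sqrt r to the second moment, hence at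
    least pi / 4. *)
Lemma moment_2_unbounded (n : nat) : exists r, 1 / 2 <= r < 1 /\ INR n * (PI / 4) <= moment 2 r.
Proof.
  assert (HP := PI_RGT_0).
  induction n as [|n [r [Hr HM]]].
  - exists (1 / 2). split; [lra|]. simpl. rewrite Rmult_0_l. apply moment_2_pos. lra.
  - exists (sqrt (sqrt r)).
    assert (Up : forall x, 1 / 2 <= x < 1 -> 1 / 2 <= sqrt x < 1).
    { intros x Hx. assert (Q := sqrt_sqrt x ltac:(lra)). assert (P := sqrt_pos x).
      split; nra. }
    assert (H1 := Up _ Hr). assert (H2 := Up _ H1). split; [exact H2|].
    rewrite moment_2_step by lra.
    replace (sqrt (sqrt r) ^ 4) with r.
    2:{ replace (sqrt (sqrt r) ^ 4) with
          ((sqrt (sqrt r) * sqrt (sqrt r)) * (sqrt (sqrt r) * sqrt (sqrt r))) by ring.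
        rewrite !sqrt_sqrt; lra. }
    rewrite S_INR. assert (1 / 4 <= sqrt (sqrt r) ^ 2) by (simpl; nra). nra.
Qed.

(** The positive part is (y + |y|) / 2, and |x| >= x^2 - x^4 for x = y / lam.  Integrated,
    this bounds a first absolute moment from below by the second and fourth moments. *)
Lemma pos_part_lower (y lam : R) : 0 < lam ->
  1 / 2 * y + 1 / 2 * (y ^ 2 / lam - y ^ 4 / lam ^ 3) <= Rmax 0 y.
Proof.
  intros Hl. assert (E : y = lam * (y / lam)) by (field; lra).
  set (x := y / lam) in *.
  replace (y ^ 2 / lam - y ^ 4 / lam ^ 3) with (lam * (x ^ 2 - x ^ 4))
    by (unfold x; field; lra).
  assert (K : x ^ 2 - x ^ 4 <= Rabs x).
  { assert (A0 := Rabs_pos x). rewrite <- (pow2_abs x).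
    replace (x ^ 4) with (Rabs x ^ 4) by (replace 4%nat with (2 * 2)%nat by reflexivity;
      rewrite !pow_mult, pow2_abs; reflexivity).
    set (a := Rabs x) in *. assert (0 <= 1 - a + a ^ 3).
    { simpl. destruct (Rle_dec a 1); nra. }
    simpl in *. nra. }
  assert (L : lam * (x ^ 2 - x ^ 4) <= lam * Rabs x) by (apply Rmult_le_compat_l; lra).
  assert (Ay : lam * Rabs x = Rabs y).
  { rewrite E, Rabs_mult, (Rabs_pos_eq lam) by lra. reflexivity. }
  unfold Rmax. destruct (Rle_dec 0 y) as [Hy|Hy].
  - rewrite (Rabs_pos_eq y Hy) in Ay. lra.
  - rewrite (Rabs_left y) in Ay by lra. lra.
Qed.

(** [pos_part_lower] with lam of the order of the square root of the second moment:
    the term in the fourth moment then cancels at most half of the one in the second.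
    The function F will be log+ |f'|. *)
Lemma circle_int_lower_unbounded (eps A B : R) : 0 < eps -> 0 <= A ->
  exists r, 0 < r < 1 /\ forall F, cont F ->
    (forall t, 0 <= F t) -> (forall t, eps * lac_re r t - A <= F t) -> B < circle_int F.
Proof.
  intros He HA. assert (HP := PI_RGT_0).
  (* The lower bound obtained at the end is eps * lam * PI / 16 - 2 * PI * A. *)
  set (L := 16 * (Rabs B + 2 * PI * A + 1) / (eps * PI)).
  assert (HL : 0 < L).
  { unfold L. apply Rdiv_lt_0_compat; [|nra]. pose proof (Rabs_pos B).
    assert (0 <= PI * A) by (apply Rmult_le_pos; lra). lra. }
  destruct (INR_unbounded (L * L)) as [n Hn].
  destruct (moment_2_unbounded n) as [r [Hr HM]].
  exists r. split; [lra|]. intros F HF Hpos Hlow.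
  set (m2 := moment 2 r) in *.
  (* With this choice the bound PI * m4 <= 2 * m2^2 reads m4 / lam^3 <= m2 / (2 * lam). *)
  set (lam := sqrt (4 * m2 / PI)).
  assert (Hm : L * L < 4 * m2 / PI).
  { apply Rlt_le_trans with (INR n); [exact Hn|].
    apply Rmult_le_reg_r with (PI / 4); [lra|].
    replace (4 * m2 / PI * (PI / 4)) with m2 by (field; lra). exact HM. }
  assert (HLL : 0 < L * L) by nra.
  assert (Q : lam * lam = 4 * m2 / PI) by (apply sqrt_sqrt; lra).
  assert (Hlam0 : 0 < lam) by (apply sqrt_lt_R0; lra).
  assert (Hlam : L < lam) by nra.
  assert (Em2 : m2 = lam * lam * PI / 4) by (rewrite Q; field; lra).
  assert (M4 := moment_4_bound r ltac:(lra)). fold m2 in M4. set (m4 := moment 4 r) in *.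
  assert (M1 := moment_1_zero r ltac:(lra)).
  assert (HY : cont (lac_re r)) by (apply lac_re_cont; lra).
  assert (Hp : forall n, cont (fun t => lac_re r t ^ n)) by (intros; apply cont_pow, HY).
  assert (Low : circle_int (fun t => eps / 2 * lac_re r t ^ 1 + (eps / (2 * lam) * lac_re r t ^ 2
      + (- (eps / (2 * lam ^ 3)) * lac_re r t ^ 4 + - A))) <= circle_int F).
  { apply circle_int_le; [auto 8 using cont_plus, cont_mult, cont_const|exact HF|].
    intros t. assert (T := pos_part_lower (lac_re r t) lam Hlam0).
    assert (U : eps * Rmax 0 (lac_re r t) - A <= F t).
    { unfold Rmax. destruct (Rle_dec 0 (lac_re r t)); [apply Hlow|].
      specialize (Hpos t). lra. }
    assert (V := Rmult_le_compat_l eps _ _ (Rlt_le _ _ He) T).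
    replace (eps * (1 / 2 * lac_re r t + 1 / 2 * (lac_re r t ^ 2 / lam - lac_re r t ^ 4 / lam ^ 3)))
      with (eps / 2 * lac_re r t ^ 1 + (eps / (2 * lam) * lac_re r t ^ 2
      + (- (eps / (2 * lam ^ 3)) * lac_re r t ^ 4))) in V by (field; lra).
    lra. }
  rewrite !circle_int_plus, !circle_int_scal, circle_int_const in Low; auto 8 using cont_plus, cont_mult, cont_const.
  change (circle_int (fun t => lac_re r t ^ 1)) with (moment 1 r) in Low.
  change (circle_int (fun t => lac_re r t ^ 2)) with m2 in Low.
  change (circle_int (fun t => lac_re r t ^ 4)) with m4 in Low. rewrite M1 in Low.
  assert (Hm4 : m4 <= lam * lam * (lam * lam) * PI / 8).
  { apply Rmult_le_reg_l with PI; [exact HP|]. eapply Rle_trans; [exact M4|].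
    right. rewrite Em2. field. }
  assert (H4 : eps / (2 * lam ^ 3) * m4 <= eps * lam * PI / 16).
  { replace (eps * lam * PI / 16) with (eps / (2 * lam ^ 3) * (lam * lam * (lam * lam) * PI / 8))
      by (field; lra).
    apply Rmult_le_compat_l; [|exact Hm4]. apply Rlt_le, Rdiv_lt_0_compat; [exact He|].
    assert (0 < lam ^ 3) by (apply pow_lt; exact Hlam0). lra. }
  assert (H2 : eps / (2 * lam) * m2 = eps * lam * PI / 8) by (rewrite Em2; field; lra).
  assert (HLe : eps * L * PI / 16 = Rabs B + 2 * PI * A + 1) by (unfold L; field; lra).
  assert (eps * L * PI / 16 <= eps * lam * PI / 16).
  { assert (0 < eps * PI) by nra. nra. }
  assert (HB := Rle_abs B). lra.
Qed.

(** * The example *)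

Lemma cont_log_plus (x : R -> R) :
  cont x -> (forall t, 0 < x t) -> cont (fun t => log_plus (x t)).
Proof.
  intros Hx Hpos.
  assert (Hln : cont (fun t => ln (x t))).
  { intros t. apply (continuous_comp x ln); [apply Hx|].
    apply continuity_pt_filterlim, derivable_continuous_pt. exists (/ x t).
    apply derivable_pt_lim_ln, Hpos. }
  apply (cont_ext (fun t => / 2 * (ln (x t) + Rabs (ln (x t))))).
  { intros t. unfold log_plus, Rmax. destruct (Rle_dec 0 (ln (x t))).
    - rewrite Rabs_pos_eq by assumption. field.
    - rewrite Rabs_left by lra. field. }
  apply cont_mult; [apply cont_const|]. apply cont_plus; [exact Hln|].
  intros t. apply (continuous_comp (fun t => ln (x t)) Rabs); [apply Hln|apply continuous_Rabs].
Qed.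

(** The primitive vanishing at 0 of k' * exp h. *)
Definition example_coef (r eps : R) (n : nat) : R :=
  match n with
  | 0%nat => 0
  | S m => PS_mult (PS_derive (koebe_coef r)) (exp_bloch_coef eps) m / INR (S m)
  end.

Section Example.
Variables r eps : R.
Hypothesis (Hr : 0 <= r < 1) (Heps : 0 < eps <= 1 / 8).

Let heps : 0 < eps <= 1 / 2.
Proof. lra. Qed.

Lemma example_deriv_coef n : PS_derive (example_coef r eps) n = PS_mult (PS_derive (koebe_coef r)) (exp_bloch_coef eps) n.
Proof. unfold PS_derive at 1, example_coef. field. apply not_0_INR. lia. Qed.

Lemma example_deriv_summable : disk_summable (PS_mult (PS_derive (koebe_coef r)) (exp_bloch_coef eps)).
Proof. apply disk_summable_mult; [apply koebe_deriv_summable, Hr|apply exp_bloch_coef_summable, heps]. Qed.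

Lemma example_coef_summable : disk_summable (example_coef r eps).
Proof.
  apply disk_summable_CV_radius. rewrite <- CV_radius_derive.
  apply disk_summable_CV_radius. apply (disk_summable_ext _ _ (fun n => eq_sym (example_deriv_coef n))).
  apply example_deriv_summable.
Qed.

Lemma example_has_deriv z : Cmod z < 1 ->
  has_cderiv (cps (example_coef r eps)) z (koebe_deriv r z * exp_bloch eps z)%C.
Proof.
  intros Hz. unfold koebe_deriv, exp_bloch.
  rewrite <- cps_mult; [|apply koebe_deriv_summable, Hr|apply exp_bloch_coef_summable, heps|exact Hz].
  rewrite <- (cps_ext _ _ z example_deriv_coef).
  apply cps_derive; [apply example_coef_summable|exact Hz].
Qed.

Lemma example_coef_2 : example_coef r eps 2 = 2 * r.
Proof.
  unfold example_coef, PS_mult, koebe_coef, geo2, PS_derive, PS_incr_1, exp_bloch_coef, exp_coef, geo.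
  simpl. unfold PS_mult, PS_derive, bloch_coef. simpl. field.
Qed.

Lemma example_coef_1 : example_coef r eps 1 = 1.
Proof.
  unfold example_coef, PS_mult, koebe_coef, geo2, PS_derive, PS_incr_1, exp_bloch_coef, exp_coef, geo.
  simpl. field.
Qed.

(** log |f'| = log |k'| + Re h is at least eps * Re l minus a constant, because k' is
    bounded away from 0. *)
Lemma example_not_nevanlinna : ~ nevanlinna (C_derive (cps (example_coef r eps))).
Proof.
  intros [_ Hlub].
  set (E := fun y => exists rho, 0 < rho < 1 /\
     y = log_plus_mean (C_derive (cps (example_coef r eps))) rho) in Hlub.
  destruct (Lub_Rbar_correct E) as [Hub _].
  assert (HB : exists B, forall y, E y -> y <= B).
  { destruct (Lub_Rbar E) as [B| |]; [exists B; exact Hub|contradiction|].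
    exists 0. intros y Hy. contradiction (Hub y Hy). }
  destruct HB as [B HB].
  assert (HA : 0 <= eps - ln ((1 - r) / 8)).
  { assert (ln ((1 - r) / 8) < 0); [|lra]. rewrite <- ln_1. apply ln_increasing; lra. }
  destruct (circle_int_lower_unbounded eps _ B (proj1 Heps) HA) as [rho [Hrho HF]].
  set (D := fun t => (koebe_deriv r (circle_point rho t) * exp_bloch eps (circle_point rho t))%C).
  assert (Hin : forall t, Cmod (circle_point rho t) < 1) by (intros; rewrite Cmod_circle; lra).
  assert (HD : forall t, C_derive (cps (example_coef r eps)) (circle_point rho t) = D t).
  { intros t. apply C_derive_eq, example_has_deriv, Hin. }
  assert (Hlow : forall t, (1 - r) / 8 * exp (Re (bloch eps (circle_point rho t))) <= Cmod (D t)).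
  { intros t. unfold D. rewrite Cmod_mult, (exp_bloch_modulus eps heps _ (Hin t)).
    apply Rmult_le_compat_r; [apply Rlt_le, exp_pos|apply koebe_deriv_lower; auto]. }
  assert (Hlow0 : forall t, 0 < (1 - r) / 8 * exp (Re (bloch eps (circle_point rho t)))).
  { intros t. apply Rmult_lt_0_compat; [lra|apply exp_pos]. }
  assert (Hpos : forall t, 0 < Cmod (D t)).
  { intros t. eapply Rlt_le_trans; [apply Hlow0|apply Hlow]. }
  assert (Hm : log_plus_mean (C_derive (cps (example_coef r eps))) rho <= B).
  { apply HB. exists rho. split; [exact Hrho|reflexivity]. }
  apply Rle_not_lt in Hm. apply Hm.
  change (B < circle_int (fun t => log_plus (Cmod (C_derive (cps (example_coef r eps)) (circle_point rho t))))).
  rewrite (circle_int_ext _ (fun t => log_plus (Cmod (D t)))) by (intros t; rewrite HD; reflexivity).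
  apply HF.
  - apply cont_log_plus; [|exact Hpos].
    apply (cont_ext (fun t => Cmod (cps (PS_mult (PS_derive (koebe_coef r)) (exp_bloch_coef eps))
              (circle_point rho t)))).
    { intros t. unfold D, koebe_deriv, exp_bloch.
      rewrite cps_mult; [reflexivity|apply koebe_deriv_summable, Hr|apply exp_bloch_coef_summable, heps|apply Hin]. }
    apply (cont_on_circle _ Cmod); [|apply Cmod_lip|lra].
    intros z Hz. eexists. apply cps_derive; [apply example_deriv_summable|exact Hz].
  - intros t. apply Rmax_l.
  - intros t. eapply Rle_trans; [|apply Rmax_r].
    eapply Rle_trans; [|apply ln_le; [apply Hlow0|apply Hlow]].
    rewrite ln_mult, ln_exp; [|lra|apply exp_pos].
    rewrite (bloch_eq eps heps _ (Hin t)), RtoC_Rmult_Re.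
    change (Re (cps lac (circle_point rho t) - circle_point rho t))
      with (lac_re rho t - Re (circle_point rho t)).
    assert (K := Re_le_Cmod (circle_point rho t)). specialize (Hin t).
    apply Rabs_le_between in K. nra.
Qed.

Lemma example_injective : 512 * eps < (1 - r) ^ 4 ->
  forall z w, Cmod z < 1 -> Cmod w < 1 -> cps (example_coef r eps) z = cps (example_coef r eps) w -> z = w.
Proof.
  intros Hsmall z w.
  apply (perturbation_injective (cps (example_coef r eps)) (koebe r) (exp_bloch eps) (bloch eps)
    (koebe_deriv r) (bloch_deriv eps) (2 / ((1 - r) * (1 - r) * (1 - r))) ((1 - r) / 16) (2 * eps)).
  - apply example_has_deriv.
  - intros x Hx. apply cps_derive; [apply koebe_coef_summable, Hr|exact Hx].
  - apply exp_bloch_has_deriv, heps.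
  - apply bloch_has_deriv, heps.
  - apply exp_bloch_modulus, heps.
  - intros x Hx. apply koebe_deriv_upper; auto.
  - apply koebe_lower, Hr.
  - lra.
  - apply bloch_deriv_bound, heps.
  - assert (P : 0 < (1 - r) * (1 - r) * (1 - r)) by (repeat apply Rmult_lt_0_compat; lra).
    (* Here 8 * c * M < m with c = 2 * eps, M = 2 / (1 - r)^3 and m = (1 - r) / 16. *)
    apply Rmult_lt_reg_r with ((1 - r) * (1 - r) * (1 - r)); [exact P|].
    replace (8 * (2 * eps) * (2 / ((1 - r) * (1 - r) * (1 - r))) * ((1 - r) * (1 - r) * (1 - r)))
      with (32 * eps) by (field; lra).
    replace ((1 - r) / 16 * ((1 - r) * (1 - r) * (1 - r))) with ((1 - r) ^ 4 / 16) by field.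
    lra.
Qed.
End Example.

Theorem theorem11 :
  forall alpha : R, 0 <= alpha < 2 ->
  exists (f : C -> C) (a : nat -> R),
    S_R f /\ normalized_real_expansion f a /\ a 2%nat = alpha /\
    ~ nevanlinna (C_derive f).
Proof.
  intros alpha Ha.
  set (r := alpha / 2). assert (Hr : 0 <= r < 1) by (unfold r; lra).
  set (eps := (1 - r) ^ 4 / 1024).
  assert (H4 : 0 < (1 - r) ^ 4 <= 1).
  { split; [apply pow_lt; lra|]. rewrite <- (pow1 4). apply pow_incr; lra. }
  assert (Heps : 0 < eps <= 1 / 8) by (unfold eps; lra).
  assert (Hexp : normalized_real_expansion (cps (example_coef r eps)) (example_coef r eps)).
  { split; [reflexivity|]. split; [apply example_coef_1|].
    intros z Hz. apply cps_is_pseries; [apply example_coef_summable; assumption|exact Hz]. }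
  exists (cps (example_coef r eps)), (example_coef r eps). repeat split.
  - intros z Hz. eexists. apply example_has_deriv; assumption.
  - apply example_injective; auto. unfold eps. lra.
  - exists (example_coef r eps). exact Hexp.
  - apply example_coef_1.
  - apply Hexp.
  - rewrite example_coef_2. unfold r. field.
  - apply example_not_nevanlinna; assumption.
Qed.
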